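(* The following problem is undecidable: given a matrix multiplication game $(\mathcal{A},\mathcal{E})$ in which $\mathcal{A}$ and $\mathcal{E}$ are finite sets of non-negative matrices with integer elements, decide whether the maximal payoff that Eve can ensure is $<2$.
   Context: Matrix multiplication game (MMG) $(\mathcal{A},\mathcal{E})$: here $\mathcal{A}$ is a nonempty set of $(M\times N)$-matrices and $\mathcal{E}$ a nonempty set of $(N\times M)$-matrices. For $i=1,2,\dots$ Adam writes $A_i\in\mathcal{A}$ and then Eve writes $E_i\in\mathcal{E}$. A strategy for Adam is a function $\sigma:(\mathcal{A}\cdot\mathcal{E})^*\to\mathcal{A}$ mapping every finite history to his next move; a strategy for Eve is a function $\tau:(\mathcal{A}\cdot\mathcal{E})^*\cdot\mathcal{A}\to\mathcal{E}$. A pair $(\sigma,\tau)$ determines a unique play $A_1E_1A_2E_2\cdots$, with payoff $P(\sigma,\tau)=\limsup_{k\to\infty}\|A_1E_1\cdots A_kE_k\|^{1/k}$, where $\|\cdot\|$ is the entrywise $1$-norm. Adam minimizes and Eve maximizes the payoff. The maximal payoff that Eve can ensure is $\sup_\tau\inf_\sigma P(\sigma,\tau)$. *)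

(* Defs.v *)
From mathcomp Require Import all_boot all_order all_algebra.
From mathcomp Require Import all_classical all_reals all_analysis.

Set Implicit Arguments.
Unset Strict Implicit.
Unset Printing Implicit Defensive.

Import Order.TTheory GRing.Theory Num.Theory.
Local Open Scope classical_set_scope.
Local Open Scope ring_scope.

(** * Matrix multiplication games over the reals *)

Section Game.
Variables (R : realType) (M N : nat).
Variables (A : set 'M[R]_(M, N)) (E : set 'M[R]_(N, M)).

(* The sets A and E are coerced to the types of their elements, so a history
   is a word of (A.E)^* with the earliest move first. *)
Definition history := seq (A * E).

Definition adam_strategy := history -> A.

Definition eve_strategy := history -> A -> E.

(* The first k rounds A_1 E_1 ... A_k E_k of the play. *)
Fixpoint play (s : adam_strategy) (t : eve_strategy) (k : nat) : history :=
  if k is k'.+1 then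
    let h := play s t k' in rcons h (s h, t h (s h))
  else [::].

Definition play_product (s : adam_strategy) (t : eve_strategy) (k : nat) :
    'M[R]_M :=
  \prod_(r <- play s t k) (val r.1 *m val r.2).

Definition norm1 (m n : nat) (X : 'M[R]_(m, n)) : R :=
  \sum_(i < m) \sum_(j < n) `|X i j|.

(* The limsup is taken in the extended reals, as A and E may be unbounded; the
   sequence is indexed from round 1 to avoid the exponent 1/0. *)
Definition payoff (s : adam_strategy) (t : eve_strategy) : \bar R :=
  limn_esup (fun k => (norm1 (play_product s t k.+1) `^ (k.+1%:R^-1))%:E).

Definition eve_value : \bar R :=
  ereal_sup [set ereal_inf [set payoff s t | s in [set: adam_strategy]]
            | t in [set: eve_strategy]].

End Game.

(** * Finite games with non-negative integer matrices *)

(* The finite sets are presented by lists; order and repetitions of the listed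
   matrices are irrelevant to the game. *)
Record nat_mmg := NatMMG {
  rows : nat;
  cols : nat;
  adam_moves : seq 'M[nat]_(rows, cols);
  eve_moves : seq 'M[nat]_(cols, rows);
  rows_gt0 : (0 < rows)%N;
  cols_gt0 : (0 < cols)%N;
  adam_moves_neq0 : adam_moves != [::];
  eve_moves_neq0 : eve_moves != [::] }.

Definition real_moves (R : realType) (m n : nat) (s : seq 'M[nat]_(m, n)) :
    set 'M[R]_(m, n) :=
  [set map_mx (fun x : nat => x%:R) X | X in [set` s]].

Arguments real_moves : clear implicits.
Arguments real_moves R {m n} s.

Definition nat_mmg_value (R : realType) (G : nat_mmg) : \bar R :=
  eve_value (real_moves R (adam_moves G)) (real_moves R (eve_moves G)).

(* [CodeSeq.code] is the explicit bijection from lists of naturals to naturals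
   with code [::] = 0 and code (n :: s) = 2 ^ n * (2 * code s + 1). *)
Definition mx_code (m n : nat) (X : 'M[nat]_(m, n)) : nat :=
  CodeSeq.code [seq CodeSeq.code [seq X i j | j <- enum 'I_n] | i <- enum 'I_m].

Definition nat_mmg_code (G : nat_mmg) : nat :=
  CodeSeq.code [:: rows G; cols G;
    CodeSeq.code [seq mx_code X | X <- adam_moves G];
    CodeSeq.code [seq mx_code X | X <- eve_moves G]].

(** * Computability by register (Minsky) machines *)

(* [Inc r] increments register r and goes to the next instruction; [Dec r l]
   jumps to instruction l if register r is zero, and otherwise decrements it
   and goes to the next instruction.  A program may use any finite number of
   registers; with unboundedly many of them available these machines compute
   exactly the partial recursive functions. *)
Inductive instr : Type := Inc of nat | Dec of nat & nat.

Definition program := seq instr.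

(* Program counter and register contents. *)
Definition config : Type := nat * (nat -> nat).

Definition set_reg (rs : nat -> nat) (r v : nat) : nat -> nat :=
  fun q => if q == r then v else rs q.

Definition exec (i : instr) (c : config) : config :=
  match i with
  | Inc r => (c.1.+1, set_reg c.2 r (c.2 r).+1)
  | Dec r l =>
      if c.2 r is v.+1 then (c.1.+1, set_reg c.2 r v) else (l, c.2)
  end.

Definition halted (p : program) (c : config) : bool := (size p <= c.1)%N.

Definition step (p : program) (c : config) : config :=
  if halted p c then c else exec (nth (Inc 0) p c.1) c.

(* The input and the output are in register 0; all other registers are
   initially zero. *)
Definition init (x : nat) : config := (0%N, fun r => if r == 0%N then x else 0%N).

Definition outputs (p : program) (x y : nat) : Prop :=
  exists k, let c := iter k (step p) (init x) in halted p c /\ c.2 0%N = y.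

(* Nothing is required of p on numbers that do not encode an instance. *)
Definition decides (T : Type) (enc : T -> nat) (P : T -> Prop) (p : program) :
    Prop :=
  forall x : T, (P x -> outputs p (enc x) 1) /\ (~ P x -> outputs p (enc x) 0).

Definition undecidable (T : Type) (enc : T -> nat) (P : T -> Prop) : Prop :=
  ~ exists p : program, decides enc P p.

(* Main.v *)
(* The vector transformed by a play stores a configuration of a Minsky machine:
   a counter c is represented by the two numbers 2^(k - c) and 2^(k + c), where
   k is the round, and the control state by a coordinate equal to 2^k.  Adam
   writes the steps of the machine.  A test of Adam on a counter comes with a
   stake, which is at most 2^k if the test is correct and at least 2^(k + 1)
   otherwise; Eve either lets Adam continue or restarts the machine with the
   stake as new scale.  Hence wrong tests never lose Eve anything, whereas
   every restart at a correct test, and every halting of the machine, costs her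
   a factor 2.  If the machine halts in T steps, Adam keeps the growth rate
   strictly below 2; if it does not, Eve ensures 2.

   Constants loaded in a counter are bounded from below only, because the game
   is monotone in its entries: the test c >= a has stake 2^a 2^(k - c).  The
   game for a program P and numbers a, b is therefore won by Adam iff P halts
   on some guess (x, y) with x >= a and y >= b.  A program that rejects
   x + y > K makes the guess exact when a + b = K.

   For a putative decision program p, the diagonal program computes K, a tower
   of 2s of height e, rejects x + y > K, interprets x as a list of operations
   that turns (x, y) into the code of a game, runs p on this code and halts iff
   p answers 0.  The operations that produce the code of the game of the
   diagonal program itself do not depend on a and b, and for large e they are
   encoded by a number t <= K: the game with a = t and b = K - t contradicts
   p. *)

From HB Require Import structures.
Require Import Defs.
From mathcomp Require Import all_boot all_order all_algebra.
From mathcomp Require Import all_classical all_reals all_analysis.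
From mathcomp Require Import zify ring lra.

Set Implicit Arguments.
Unset Strict Implicit.
Unset Printing Implicit Defensive.

Import Order.TTheory GRing.Theory Num.Theory.
Import numFieldNormedType.Exports.

(** * Register machines *)

Definition halts (P : program) (c : config) : Prop :=
  exists k, halted P (iter k (step P) c).

Definition reaches (P : program) (c d : config) : Prop :=
  exists k, iter k (step P) c = d.

Lemma reaches_refl P c : reaches P c c.
Proof. by exists 0. Qed.

Lemma reaches_trans P c d e : reaches P c d -> reaches P d e -> reaches P c e.
Proof. by move=> [k <-] [l <-]; exists (l + k); rewrite iterD. Qed.

Lemma reaches_step P c d e : step P c = d -> reaches P d e -> reaches P c e.
Proof. by move=> <- [k <-]; exists k.+1; rewrite iterSr. Qed.

Lemma iter_step_halted P k c : halted P c -> iter k (step P) c = c.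
Proof. by move=> hc; elim: k => //= k ->; rewrite /step hc. Qed.

(** A halted configuration is a fixed point of [step], so running past the halting time is
    harmless. *)
Lemma reaches_halts P c d : reaches P c d -> halts P c <-> halts P d.
Proof.
move=> [k <-]; split=> [[l hl]|[l hl]]; last by exists (l + k); rewrite iterD.
exists l; rewrite -iterD addnC iterD.
by rewrite iter_step_halted.
Qed.

Lemma halts_halted P c : halted P c -> halts P c.
Proof. by exists 0. Qed.

Lemma fixed_halts P c : step P c = c -> ~~ halted P c -> ~ halts P c.
Proof. by move=> sc nh [k]; rewrite iter_fix // (negbTE nh). Qed.

(** Jump targets are absolute, so a fragment is correct only at the address it was compiled for. *)
Definition occurs (P : program) (o : nat) (Q : program) : Prop :=
  exists P1 P2, P = P1 ++ Q ++ P2 /\ size P1 = o.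

Lemma occurs_catl P o Q1 Q2 : occurs P o (Q1 ++ Q2) -> occurs P o Q1.
Proof.
by move=> [P1 [P2 [-> <-]]]; exists P1, (Q2 ++ P2); rewrite !catA.
Qed.

Lemma occurs_catr P o Q1 Q2 :
  occurs P o (Q1 ++ Q2) -> occurs P (o + size Q1) Q2.
Proof.
move=> [P1 [P2 [-> <-]]]; exists (P1 ++ Q1), P2.
by rewrite size_cat !catA.
Qed.

Lemma step_at P o Q j rs : occurs P o Q -> j < size Q ->
  step P (o + j, rs) = exec (nth (Inc 0) Q j) (o + j, rs).
Proof.
move=> [P1 [P2 [-> <-]]] lt_jQ; rewrite /step /halted /= !size_cat leqNgt.
rewrite ltn_add2l ltn_addr //= !nth_cat ltnNge leq_addr /=.
by rewrite addKn lt_jQ.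
Qed.

Lemma step_at0 P o Q rs : occurs P o Q -> 0 < size Q ->
  step P (o, rs) = exec (nth (Inc 0) Q 0) (o, rs).
Proof. by move=> /step_at h /h => /(_ rs); rewrite addn0. Qed.

(** The default 0 makes a list stand for infinitely many registers, almost all zero. *)
Definition regs (l : seq nat) : nat -> nat := nth 0 l.

Lemma set_regs l r v : r < size l ->
  set_reg (regs l) r v = regs (set_nth 0 l r v).
Proof.
by move=> ltr; apply: funext => q; rewrite /set_reg /regs nth_set_nth.
Qed.

(* [CFor r c] is a bounded loop, run as many times as register [r] indicates,
   as long as [c] does not write to [r] (see [wf_cmd]). *)
Inductive cmd : Type :=
  | CInc of nat
  | CDec of nat
  | CSkip
  | CSeq of cmd & cmd
  | CFor of nat & cmd.

Definition bump_reg (f : nat -> nat) r l := set_nth 0 l r (f (nth 0 l r)).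

(** A loop consumes its register: each pass decrements it first, and it is zero at the end if the
    body does not write to it. *)
Fixpoint sem (c : cmd) (l : seq nat) : seq nat :=
  match c with
  | CInc r => bump_reg succn r l
  | CDec r => bump_reg predn r l
  | CSkip => l
  | CSeq c1 c2 => sem c2 (sem c1 l)
  | CFor r c => iter (nth 0 l r) (fun l => sem c (bump_reg predn r l)) l
  end.

Fixpoint writes (c : cmd) : seq nat :=
  match c with
  | CInc r | CDec r => [:: r]
  | CSkip => [::]
  | CSeq c1 c2 => writes c1 ++ writes c2
  | CFor r c => r :: writes c
  end.

Fixpoint wf_cmd (c : cmd) : bool :=
  match c with
  | CSeq c1 c2 => wf_cmd c1 && wf_cmd c2
  | CFor r c => (r \notin writes c) && wf_cmd c
  | _ => true
  end.

Fixpoint csize (c : cmd) : nat :=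
  match c with
  | CInc _ | CDec _ => 1
  | CSkip => 0
  | CSeq c1 c2 => csize c1 + csize c2
  | CFor r c => (csize c).+2
  end.

(* [Dec z o] jumps unconditionally to [o] as long as register [z] is zero. *)
Fixpoint compile (z o : nat) (c : cmd) : program :=
  match c with
  | CInc r => [:: Inc r]
  | CDec r => [:: Dec r o.+1]
  | CSkip => [::]
  | CSeq c1 c2 => compile z o c1 ++ compile z (o + csize c1) c2
  | CFor r c => Dec r (o + csize c).+2 :: rcons (compile z o.+1 c) (Dec z o)
  end.

Lemma size_compile z o c : size (compile z o c) = csize c.
Proof.
elim: c o => //= [c1 IH1 c2 IH2|r c IH] o; first by rewrite size_cat IH1 IH2.
by rewrite size_rcons IH.
Qed.

Lemma sem_iter_preserved (c : cmd) (T : Type) (m : seq nat -> T) r n l :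
  (forall l, m (sem c (bump_reg predn r l)) = m l) ->
  m (iter n (fun l => sem c (bump_reg predn r l)) l) = m l.
Proof. by move=> h; elim: n => //= n <-. Qed.

Lemma nth_bump_reg f r l q :
  nth 0 (bump_reg f r l) q = if q == r then f (nth 0 l r) else nth 0 l q.
Proof. by rewrite /bump_reg nth_set_nth. Qed.

Lemma size_bump_reg f r l : r < size l -> size (bump_reg f r l) = size l.
Proof. by move=> h; rewrite size_set_nth; apply/maxn_idPr. Qed.

Lemma nth_sem c l q : q \notin writes c -> nth 0 (sem c l) q = nth 0 l q.
Proof.
elim: c l => //= [r|r|c1 IH1 c2 IH2|r c IH] l.
- by rewrite inE nth_bump_reg => /negbTE ->.
- by rewrite inE nth_bump_reg => /negbTE ->.
- by rewrite mem_cat negb_or => /andP[/IH1 h1 /IH2 ->].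
- rewrite inE negb_or => /andP[/negbTE qr /IH h].
  apply: (@sem_iter_preserved c _ (fun l => nth 0 l q)) => {}l.
  by rewrite h nth_bump_reg qr.
Qed.

Lemma size_sem c l : all (fun r => r < size l) (writes c) ->
  size (sem c l) = size l.
Proof.
elim: c l => //= [r|r|c1 IH1 c2 IH2|r c IH] l.
- by rewrite andbT; apply: size_bump_reg.
- by rewrite andbT; apply: size_bump_reg.
- by rewrite all_cat => /andP[/IH1 h1 h2]; rewrite IH2 h1.
- case/andP=> ltr h.
  suff: forall n, size (iter n (fun l => sem c (bump_reg predn r l)) l) = size l.
    exact.
  elim=> //= n IHn; rewrite IH size_bump_reg ?IHn //.
Qed.

(** Induction on the command, and for a loop on the content of its register. Register [z] is never
    written, so the closing [Dec z o] always jumps back. *)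
Lemma reaches_compile (P : program) z o c l :
  wf_cmd c -> all (fun r => (r < size l) && (r != z)) (writes c) ->
  nth 0 l z = 0 ->
  occurs P o (compile z o c) ->
  reaches P (o, regs l) (o + csize c, regs (sem c l)).
Proof.
elim: c o l => [r|r||c1 IH1 c2 IH2|r c IH] o l.
- move=> _ /=; rewrite andbT => /andP[ltr _] _ occ.
  apply: reaches_step (reaches_refl _ _).
  by rewrite (step_at0 _ occ) //= set_regs // addn1.
- move=> _ /=; rewrite andbT => /andP[ltr _] _ occ.
  apply: reaches_step (reaches_refl _ _).
  rewrite (step_at0 _ occ) //= addn1 /bump_reg; case E: (regs l r) => [|v] /=.
    (* On a zero register the machine writes nothing, while [sem] writes the predecessor of 0, which
       is again 0. *)
    congr (_, _); apply: funext => q; rewrite /regs nth_set_nth /=.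
    by case: eqP => // ->; rewrite -/(regs l r) E.
  by rewrite set_regs // -[nth 0 l r]/(regs l r) E.
- by rewrite /= addn0 => *; apply: reaches_refl.
- move=> /= /andP[w1 w2]; rewrite all_cat => /andP[a1 a2] lz occ.
  apply: reaches_trans (IH1 _ _ w1 a1 lz (occurs_catl occ)) _.
  rewrite addnA; apply: IH2 => //.
  + rewrite size_sem //; apply: sub_all a1 => ? /andP[] //.
  + rewrite nth_sem //; apply/negP => /(allP a1) /andP[_].
    by rewrite eqxx.
  + by have := occurs_catr occ; rewrite size_compile.
move=> /= /andP[nr wc] /andP[/andP[ltr rz] a] lz occ.
have occ1 : occurs P o.+1 (compile z o.+1 c).
  have := @occurs_catr P o [:: Dec r (o + csize c).+2] _ occ.
  by rewrite -cats1 addn1 => /occurs_catl.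
move En: (nth 0 l r) => n.
elim: n l En ltr a lz => [|n IHn] l En ltr a lz.
  apply: reaches_step (reaches_refl _ _).
  by rewrite (step_at0 _ occ) //= -[regs l r]/(nth 0 l r) En !addnS.
apply: (@reaches_step _ _ (o.+1, regs (bump_reg predn r l))).
  by rewrite (step_at0 _ occ) //= -[regs l r]/(nth 0 l r) En set_regs // /bump_reg En.
have sb : size (bump_reg predn r l) = size l by rewrite size_bump_reg.
have zb : nth 0 (bump_reg predn r l) z = 0.
  by rewrite nth_bump_reg eq_sym (negbTE rz).
apply: reaches_trans (IH _ _ wc _ zb occ1) _; first by rewrite sb.
have zs : nth 0 (sem c (bump_reg predn r l)) z = 0.
  rewrite nth_sem //; apply/negP => /(allP a) /andP[_].
  by rewrite eqxx.
have ss : size (sem c (bump_reg predn r l)) = size l.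
  by rewrite size_sem sb //; apply: sub_all a => ? /andP[].
apply: (@reaches_step _ _ (o, regs (sem c (bump_reg predn r l)))).
  rewrite addSnnS (step_at (j := (csize c).+1) _ occ) /=; last first.
    by rewrite size_rcons size_compile.
  rewrite nth_rcons size_compile ltnn eqxx /=.
  by rewrite -[regs _ z]/(nth 0 _ z) zs.
rewrite iterSr; apply: IHn; rewrite ?ss //.
by rewrite nth_sem // nth_bump_reg eqxx En.
Qed.

(** * Programs for towers of exponentials and encoded operations *)

Local Notation "c1 ;; c2" := (CSeq c1 c2) (at level 60, right associativity).

Lemma sem_move r q l : r != q -> r < size l -> q < size l ->
  sem (CFor r (CInc q)) l =
  set_nth 0 (set_nth 0 l r 0) q (nth 0 l q + nth 0 l r).
Proof.
move=> neq ltr ltq; rewrite -[LHS]/(iter (nth 0 l r) _ _).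
move En: (nth 0 l r) => n; elim: n l En ltr ltq => [|n IHn] l En ltr ltq.
  apply: (@eq_from_nth _ 0).
    by rewrite !size_set_nth !(maxn_idPr _) ?(maxn_idPr _).
  move=> i _; rewrite !nth_set_nth /= addn0.
  case: (i =P q) => [->//|_]; rewrite nth_set_nth /=.
  by case: (i =P r) => // ->.
rewrite iterSr IHn ?size_bump_reg ?size_bump_reg //=; last first.
  by rewrite !nth_bump_reg (negbTE neq) eqxx En.
apply: (@eq_from_nth _ 0).
  by rewrite !size_set_nth; lia.
move=> i _; rewrite !nth_set_nth /= !nth_set_nth /= !nth_bump_reg eqxx.
rewrite [q == r]eq_sym (negbTE neq) addSnnS.
by case: (i =P q) => // _; case: (i =P r).
Qed.

Lemma sem_seq c1 c2 l : sem (c1 ;; c2) l = sem c2 (sem c1 l).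
Proof. by []. Qed.

(** Acts on register 2. Registers 3 and 4 are scratch space, zero between uses of [cmd_double] and
    [cmd_exp2] except for the loop count of the latter. *)
Definition cmd_double : cmd :=
  CFor 2 (CInc 4 ;; CInc 4) ;; CFor 4 (CInc 2).

Definition cmd_exp2 : cmd :=
  CFor 2 (CInc 3) ;; CInc 2 ;; CFor 3 cmd_double.

Lemma sem_double x y a b l :
  sem cmd_double [:: x, y, a, b, 0 & l] = [:: x, y, a.*2, b, 0 & l].
Proof.
have h1 c : sem (CFor 2 (CInc 4 ;; CInc 4)) [:: x, y, a, b, c & l]
    = [:: x, y, 0, b, c + a.*2 & l].
  rewrite -[LHS]/(iter a _ _); elim: a c => [|a IHa] c; first by rewrite addn0.
  by rewrite iterSr IHa doubleS !addnS !addSn.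
by rewrite -[LHS]/(sem (CFor 4 (CInc 2)) (sem (CFor 2 (CInc 4 ;; CInc 4)) _)) h1
  sem_move.
Qed.

Lemma sem_exp2 x y a l :
  sem cmd_exp2 [:: x, y, a, 0, 0 & l] = [:: x, y, 2 ^ a, 0, 0 & l].
Proof.
have h2 c d : sem (CFor 3 cmd_double) [:: x, y, c, d, 0 & l]
    = [:: x, y, c * 2 ^ d, 0, 0 & l].
  rewrite -[LHS]/(iter d _ _); elim: d c => [|d IHd] c; first by rewrite muln1.
  rewrite iterSr -[X in iter _ _ X]/(sem cmd_double [:: x, y, c, d, 0 & l]).
  by rewrite sem_double IHd expnS -mul2n mulnCA mulnA.
rewrite -[LHS]/(sem (CFor 3 cmd_double) (sem (CInc 2) (sem (CFor 2 (CInc 3)) _))).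
rewrite sem_move // -[sem (CInc 2) _]/[:: x, y, 1, a, 0 & l].
by rewrite h2 mul1n.
Qed.

(* Base 4 digits of a sequence of operations; the digit 0 does nothing, so that
   running past the leading digit is harmless. *)
Definition digit_op (d z : nat) : nat :=
  match d with 1 => z.*2 | 2 => z.*2.+1 | 3 => 2 ^ z | _ => z end.

Definition op_step (mz : nat * nat) : nat * nat :=
  (mz.1 %/ 4, digit_op (mz.1 %% 4) mz.2).

(** The number [t] is its own iteration count: it has at most [t] base 4 digits to execute. *)
Definition run_ops (t z : nat) : nat := (iter t op_step (t, z)).2.

(* One-hot encoding of a residue modulo 4 in registers 7 .. 10. *)
Definition cmd_rotate : cmd :=
  CFor 10 (CInc 11 ;; CInc 6) ;; CFor 9 (CInc 10) ;; CFor 8 (CInc 9) ;;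
  CFor 7 (CInc 8) ;; CFor 11 (CInc 7).

(** Divides register 5 by 4, with quotient in register 6 and remainder one-hot. A loop on a flag is
    a conditional; the last loop only clears the flag of digit 0. *)
Definition cmd_digit : cmd :=
  CInc 7 ;; CFor 5 cmd_rotate ;; CFor 6 (CInc 5) ;;
  CFor 8 cmd_double ;; CFor 9 (cmd_double ;; CInc 2) ;; CFor 10 cmd_exp2 ;;
  CFor 7 CSkip.

Lemma sem_digit x y z m l :
  sem cmd_digit [:: x, y, z, 0, 0, m, 0, 0, 0, 0, 0, 0 & l] =
  [:: x, y, digit_op (m %% 4) z, 0, 0, m %/ 4, 0, 0, 0, 0, 0, 0 & l].
Proof.
(* Residue [j], quotient [h] so far, and [k] units still to be divided. *)
pose hot j h k : seq nat := [:: x, y, z, 0, 0, k, h,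
  (j == 0 : nat), (j == 1 : nat), (j == 2 : nat), (j == 3 : nat), 0 & l].
have h1 k j h : j < 4 -> sem (CFor 5 cmd_rotate) (hot j h k) =
    hot ((j + k) %% 4) (h + (j + k) %/ 4) 0.
  rewrite -[LHS]/(iter k _ _); elim: k j h => [|k IHk] j h lt_j4.
    by rewrite !addn0 modn_small // divn_small // addn0.
  rewrite iterSr -[X in iter k _ X]/(sem cmd_rotate (bump_reg predn 5 (hot j h k.+1))).
  have -> : sem cmd_rotate (bump_reg predn 5 (hot j h k.+1)) =
      hot (j.+1 %% 4) (h + j.+1 %/ 4) k.
    case: j lt_j4 => [|[|[|[|//]]]] _ /=; by rewrite ?addn0 ?addn1.
  rewrite IHk ?ltn_mod // -addnA modnDml addSnnS; congr (hot _ (_ + _) _).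
  rewrite -addSnnS [in RHS](divn_eq j.+1 4) -addnA divnMDl //.
rewrite -[LHS]/(sem (CFor 8 cmd_double ;; CFor 9 (cmd_double ;; CInc 2) ;;
  CFor 10 cmd_exp2 ;; CFor 7 CSkip)
  (sem (CFor 6 (CInc 5)) (sem (CFor 5 cmd_rotate) (hot 0 0 m)))).
rewrite h1 // sem_move //= !add0n.
have : m %% 4 < 4 by rewrite ltn_mod.
case: (m %% 4) => [|[|[|[|//]]]] _; first by [].
- rewrite -[LHS]/(sem (CFor 9 (cmd_double ;; CInc 2) ;; CFor 10 cmd_exp2 ;;
    CFor 7 CSkip)
    (sem cmd_double [:: x, y, z, 0, 0, m %/ 4, 0, 0, 0, 0, 0, 0 & l])).
  by rewrite sem_double.
- rewrite -[LHS]/(sem (CFor 10 cmd_exp2 ;; CFor 7 CSkip) (sem (CInc 2)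
    (sem cmd_double [:: x, y, z, 0, 0, m %/ 4, 0, 0, 0, 0, 0, 0 & l]))).
  by rewrite sem_double.
- rewrite -[LHS]/(sem (CFor 7 CSkip)
    (sem cmd_exp2 [:: x, y, z, 0, 0, m %/ 4, 0, 0, 0, 0, 0, 0 & l])).
  by rewrite sem_exp2.
Qed.

(** A program needs only [e] increments beyond a fixed part to reach this bound, which outgrows
    every fixed iterate of exponentials of [e]. *)
Definition tower (n : nat) : nat := iter n (expn 2) 0.

(* Registers 0 and 1 hold the guesses and register 13 holds e.  Register 18
   stays zero, for unconditional jumps, and register 19 is the input and output
   register of the decision program. *)
Definition cmd_bound : cmd :=
  CFor 13 cmd_exp2 ;;
  CFor 0 (CInc 5 ;; CInc 12 ;; CInc 14 ;; CInc 15) ;;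
  CFor 1 (CInc 15 ;; CInc 16) ;;
  CFor 2 (CDec 15).

(** Register 15 ends at zero iff the guess is within the bound. The copies of [x] serve as digits
    (5), as iteration count (12) and for the seed (14). *)
Lemma sem_bound x y e l :
  sem cmd_bound
    [:: x, y, 0, 0, 0, 0, 0, 0, 0, 0, 0, 0, 0, e, 0, 0, 0 & l] =
    [:: 0, 0, 0, 0, 0, x, 0, 0, 0, 0, 0, 0, x, 0, x, x + y - tower e, y & l].
Proof.
have h1 a : sem (CFor 13 cmd_exp2)
    [:: x, y, a, 0, 0, 0, 0, 0, 0, 0, 0, 0, 0, e, 0, 0, 0 & l] =
    [:: x, y, iter e (expn 2) a, 0, 0, 0, 0, 0, 0, 0, 0, 0, 0, 0, 0, 0, 0 & l].
  rewrite -[LHS]/(iter e _ _); elim: e a => // e IHe a.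
  rewrite iterSr -[X in iter e _ X]/(sem cmd_exp2
    [:: x, y, a, 0, 0, 0, 0, 0, 0, 0, 0, 0, 0, e, 0, 0, 0 & l]).
  by rewrite sem_exp2 IHe iterSr.
have h2 a b c d f : sem (CFor 0 (CInc 5 ;; CInc 12 ;; CInc 14 ;; CInc 15))
    [:: x, y, a, 0, 0, b, 0, 0, 0, 0, 0, 0, c, 0, d, f, 0 & l] =
    [:: 0, y, a, 0, 0, b + x, 0, 0, 0, 0, 0, 0, c + x, 0, d + x, f + x, 0 & l].
  rewrite -[LHS]/(iter x _ _).
  elim: x b c d f {h1} => [|n IHn] b c d f; first by rewrite !addn0.
  by rewrite iterSr IHn !addnS !addSn.
have h3 a b c d f g : sem (CFor 1 (CInc 15 ;; CInc 16))
    [:: 0, y, a, 0, 0, b, 0, 0, 0, 0, 0, 0, c, 0, d, f, g & l] =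
    [:: 0, 0, a, 0, 0, b, 0, 0, 0, 0, 0, 0, c, 0, d, f + y, g + y & l].
  rewrite -[LHS]/(iter y _ _).
  elim: y f g {h1 h2} => [|n IHn] f g; first by rewrite !addn0.
  by rewrite iterSr IHn !addnS !addSn.
have h4 a b c d f g : sem (CFor 2 (CDec 15))
    [:: 0, 0, a, 0, 0, b, 0, 0, 0, 0, 0, 0, c, 0, d, f, g & l] =
    [:: 0, 0, 0, 0, 0, b, 0, 0, 0, 0, 0, 0, c, 0, d, f - a, g & l].
  rewrite -[LHS]/(iter a _ _).
  elim: a f {h1 h2 h3} => [|n IHn] f; first by rewrite subn0.
  by rewrite iterSr IHn -subn1 -subnDA.
rewrite -[LHS]/(sem (CFor 2 (CDec 15)) (sem (CFor 1 (CInc 15 ;; CInc 16))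
  (sem (CFor 0 (CInc 5 ;; CInc 12 ;; CInc 14 ;; CInc 15))
  (sem (CFor 13 cmd_exp2) _)))).
by rewrite h1 h2 h3 h4.
Qed.

(** Register 17 keeps [2 ^ x], the number of doublings applied to [(2 ^ (2 ^ y)).*2.+1]; this gives
    the seed, on which the digits of [x] are then executed. *)
Definition cmd_load : cmd :=
  CFor 14 (CInc 2) ;; cmd_exp2 ;; CFor 2 (CInc 17) ;;
  CFor 16 (CInc 2) ;; cmd_exp2 ;; cmd_exp2 ;; cmd_double ;; CInc 2 ;;
  CFor 17 cmd_double ;; CFor 12 cmd_digit ;; CFor 2 (CInc 19).

(* The code of the list [:: 2 ^ x; 2 ^ y]. *)
Definition seed (x y : nat) : nat := 2 ^ (2 ^ x) * (2 ^ (2 ^ y)).*2.+1.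

Lemma sem_load x y l :
  sem cmd_load
    [:: 0, 0, 0, 0, 0, x, 0, 0, 0, 0, 0, 0, x, 0, x, 0, y, 0, 0, 0 & l] =
    [:: 0, 0, 0, 0, 0, (iter x op_step (x, seed x y)).1, 0, 0, 0, 0, 0, 0, 0, 0,
        0, 0, 0, 0, 0, run_ops x (seed x y) & l].
Proof.
pose f a m n u v w o : seq nat :=
  [:: 0, 0, a, 0, 0, m, 0, 0, 0, 0, 0, 0, n, 0, u, 0, v, w, 0, o & l].
have exp2 a m n u v w o : sem cmd_exp2 (f a m n u v w o) = f (2 ^ a) m n u v w o.
  exact: sem_exp2.
have double a m n u v w o : sem cmd_double (f a m n u v w o) = f a.*2 m n u v w o.
  exact: sem_double.
have doubles a m n u v w o :
    sem (CFor 17 cmd_double) (f a m n u v w o) = f (2 ^ w * a) m n u v 0 o.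
  rewrite -[LHS]/(iter w _ _); elim: w a => [|w IHw] a; first by rewrite mul1n.
  rewrite iterSr -[X in iter w _ X]/(sem cmd_double (f a m n u v w o)).
  by rewrite double IHw expnS -mul2n mulnCA mulnA.
have digits a m n u v w o : sem (CFor 12 cmd_digit) (f a m n u v w o) =
    f (iter n op_step (m, a)).2 (iter n op_step (m, a)).1 0 u v w o.
  rewrite -[LHS]/(iter n _ _); elim: n m a => // n IHn m a.
  rewrite iterSr -[X in iter n _ X]/(sem cmd_digit (f a m n u v w o)).
  by rewrite sem_digit IHn iterSr.
have s1 a m n u v w o :
    sem (CFor 14 (CInc 2)) (f a m n u v w o) = f (a + u) m n 0 v w o.
  by rewrite sem_move.
have s2 a m n u v w o :
    sem (CFor 2 (CInc 17)) (f a m n u v w o) = f 0 m n u v (w + a) o.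
  by rewrite sem_move.
have s3 a m n u v w o :
    sem (CFor 16 (CInc 2)) (f a m n u v w o) = f (a + v) m n u 0 w o.
  by rewrite sem_move.
have s4 a m n u v w o :
    sem (CFor 2 (CInc 19)) (f a m n u v w o) = f 0 m n u v w (o + a).
  by rewrite sem_move.
have inc a m n u v w o : sem (CInc 2) (f a m n u v w o) = f a.+1 m n u v w o.
  by [].
rewrite -[X in sem _ X]/(f 0 x x x y 0 0) /cmd_load.
rewrite sem_seq s1 sem_seq exp2 sem_seq s2 sem_seq s3 sem_seq exp2 sem_seq exp2.
rewrite sem_seq double sem_seq inc sem_seq doubles sem_seq digits s4.
by rewrite !add0n.
Qed.

(** * The diagonal program *)

Section Relocation.
Variables (R o : nat) (p P : program).

(** Clipping the targets at [size p] turns every way of halting into arrival at the first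
    instruction after the copy. *)
Definition relocate_instr (i : instr) : instr :=
  match i with
  | Inc r => Inc (R + r)
  | Dec r l => Dec (R + r) (o + minn l (size p))
  end.

Definition relocate : program := map relocate_instr p.

Definition stack_regs (l : seq nat) (rs : nat -> nat) : nat -> nat :=
  fun q => if q < R then nth 0 l q else rs (q - R).

Lemma set_stack_regs l rs r v :
  set_reg (stack_regs l rs) (R + r) v = stack_regs l (set_reg rs r v).
Proof.
apply: funext => q; rewrite /set_reg /stack_regs.
case: ltnP => [ltqR|leRq]; first by case: eqP => // Eq; lia.
by have -> : (q == R + r) = (q - R == r) by lia.
Qed.

Definition relocate_config (l : seq nat) (c : config) : config :=
  (o + minn c.1 (size p), stack_regs l c.2).

Hypothesis occ : occurs P o relocate.

Lemma step_relocate l c : ~~ halted p c ->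
  step P (relocate_config l c) = relocate_config l (step p c).
Proof.
case: c => pc rs nh; have := nh; rewrite /halted /= -ltnNge => lt_pc.
rewrite /relocate_config /= (minn_idPl (ltnW lt_pc)).
rewrite (step_at _ occ) ?size_map // (nth_map (Inc 0)) //.
have stackE r : stack_regs l rs (R + r) = rs r.
  by rewrite /stack_regs ltnNge leq_addr addKn.
rewrite /step (negbTE nh) /=.
case: (nth (Inc 0) p pc) => [r|r k] /=.
  by rewrite set_stack_regs stackE (minn_idPl lt_pc) addnS.
rewrite stackE; case: (rs r) => [|v] //=.
by rewrite set_stack_regs (minn_idPl lt_pc) addnS.
Qed.

Lemma reaches_relocate l c k :
  reaches P (relocate_config l c) (relocate_config l (iter k (step p) c)).
Proof.
elim: k => [|k IHk]; first exact: reaches_refl.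
apply: reaches_trans IHk _ => /=.
set d := iter k _ _; have [hd|nhd] := boolP (halted p d).
  by rewrite /step hd; apply: reaches_refl.
exact: reaches_step (step_relocate l nhd) (reaches_refl _ _).
Qed.

End Relocation.

(** An instruction that jumps to itself; this is how the diagonal program diverges on purpose. *)
Lemma stuck P o r rs : occurs P o [:: Dec r o] -> rs r = 0 ->
  ~ halts P (o, rs).
Proof.
move=> occ rs0; apply: fixed_halts.
  by rewrite (step_at0 _ occ) //= rs0.
case: occ => P1 [P2 [-> <-]].
by rewrite /halted /= !size_cat -ltnNge -[ltnLHS]addn0 ltn_add2l.
Qed.

(** * Assembly of the diagonal program *)

Section Diagonal.
Variables (e : nat) (p : program).

(** The parameter [e] is loaded in unary, so it costs exactly [e] instructions. *)
Definition cmd_start : cmd := iter e (CSeq (CInc 13)) cmd_bound.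

Definition off_test := csize cmd_start.
Definition off_load := off_test + 2.
Definition off_p := off_load + csize cmd_load.
Definition off_end := off_p + size p.

(** Each of the two explicit pairs is a zero test followed by a self-loop: the first traps guesses
    over the bound, the second traps nonzero answers of [p]. A zero answer jumps past the end. *)
Definition diag : program :=
  compile 18 0 cmd_start ++
  [:: Dec 15 off_load; Dec 18 off_test.+1] ++
  compile 18 off_load cmd_load ++
  relocate 19 off_p p ++
  [:: Dec 19 off_end.+2; Dec 18 off_end.+1].

Lemma size_diag : size diag = off_end.+2.
Proof.
rewrite !size_cat !size_compile size_map /off_end /off_p /off_load /off_test /=.
by lia.
Qed.

Lemma occurs_start : occurs diag 0 (compile 18 0 cmd_start).
Proof. by exists [::]; eexists; split; first exact: erefl. Qed.

Lemma occurs_diag : occurs diag 0 diag.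
Proof. by exists [::], [::]; rewrite cats0. Qed.

Lemma occurs_test : occurs diag off_test [:: Dec 15 off_load; Dec 18 off_test.+1].
Proof.
have := occurs_catr occurs_diag.
by rewrite size_compile add0n => /occurs_catl.
Qed.

Lemma occurs_load : occurs diag off_load (compile 18 off_load cmd_load).
Proof.
have := occurs_catr (occurs_catr occurs_diag).
by rewrite size_compile add0n => /occurs_catl.
Qed.

Lemma occurs_p : occurs diag off_p (relocate 19 off_p p).
Proof.
have := occurs_catr (occurs_catr (occurs_catr occurs_diag)).
by rewrite !size_compile add0n => /occurs_catl.
Qed.

Lemma occurs_end : occurs diag off_end [:: Dec 19 off_end.+2; Dec 18 off_end.+1].
Proof.
have := occurs_catr (occurs_catr (occurs_catr (occurs_catr occurs_diag))).
by rewrite !size_compile size_map add0n.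
Qed.

Lemma sem_start x y l :
  sem cmd_start
    [:: x, y, 0, 0, 0, 0, 0, 0, 0, 0, 0, 0, 0, 0, 0, 0, 0 & l] =
    [:: 0, 0, 0, 0, 0, x, 0, 0, 0, 0, 0, 0, x, 0, x, x + y - tower e, y & l].
Proof.
suff h k a : sem (iter k (CSeq (CInc 13)) cmd_bound)
    [:: x, y, 0, 0, 0, 0, 0, 0, 0, 0, 0, 0, 0, a, 0, 0, 0 & l] =
    sem cmd_bound
    [:: x, y, 0, 0, 0, 0, 0, 0, 0, 0, 0, 0, 0, k + a, 0, 0, 0 & l].
  by rewrite h sem_bound addn0.
elim: k a => // k IHk a; rewrite iterS sem_seq.
rewrite -[sem (CInc 13) _]/[:: x, y, 0, 0, 0, 0, 0, 0, 0, 0, 0, 0, 0, a.+1, 0, 0, 0 & l].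
by rewrite IHk addSnnS.
Qed.

Lemma wf_start : wf_cmd cmd_start.
Proof. by rewrite /cmd_start; elim: e. Qed.

Lemma writes_start : all (fun r => r < 18) (writes cmd_start).
Proof. by rewrite /cmd_start; elim: e. Qed.

Lemma regs_pad l k : regs (l ++ nseq k 0) = regs l.
Proof.
apply: funext => q; rewrite /regs nth_cat nth_nseq; case: ltnP => // h.
by rewrite (nth_default _ h); case: ifP.
Qed.

Lemma reaches_test x y : reaches diag (0, regs [:: x; y])
  (off_test, regs [:: 0; 0; 0; 0; 0; x; 0; 0; 0; 0; 0; 0; x; 0; x;
                      x + y - tower e; y; 0; 0; 0]).
Proof.
(* Twenty explicit entries keep all writes up to register 19 inside the list. *)
rewrite -(regs_pad _ 18) -[_ ++ _]/[:: x, y, 0, 0, 0, 0, 0, 0, 0, 0, 0, 0, 0, 0,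
  0, 0, 0 & [:: 0; 0; 0]].
rewrite -sem_start; apply: (reaches_compile (z := 18)) => //.
- exact: wf_start.
- by apply: sub_all writes_start => r /= ?; lia.
- exact: occurs_start.
Qed.

Lemma diag_overflow x y : tower e < x + y -> ~ halts diag (0, regs [:: x; y]).
Proof.
move=> lt_xy /(reaches_halts (reaches_test x y)).
have [v Ev] : {v | x + y - tower e = v.+1}.
  by exists (x + y - tower e).-1; lia.
rewrite Ev; set l := (X in regs X); set l' := set_nth 0 l 15 v.
have s1 : step diag (off_test, regs l) = (off_test.+1, regs l').
  by rewrite (step_at0 _ occurs_test) //= set_regs.
move=> /(reaches_halts (reaches_step s1 (reaches_refl _ _))).
apply: (@stuck _ _ 18) => //.
by have := @occurs_catr _ _ [:: _] _ occurs_test; rewrite addn1.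
Qed.

(** Once the bound test is passed, [x] is executed as operations on the seed of [(x, y)], and only
    the answer of [p] on the result decides about halting. *)
Lemma diag_halts x y v : x + y <= tower e ->
  outputs p (run_ops x (seed x y)) v ->
  halts diag (0, regs [:: x; y]) <-> v = 0.
Proof.
move=> le_xy [k [hk out]].
apply: (iff_trans (reaches_halts (reaches_test x y))).
move/eqP: le_xy => ->; set l := (X in regs X).
have s1 : step diag (off_test, regs l) = (off_load, regs l).
  by rewrite (step_at0 _ occurs_test).
apply: (iff_trans (reaches_halts (reaches_step s1 (reaches_refl _ _)))).
apply: (iff_trans (reaches_halts (reaches_compile (z := 18) _ _ _ occurs_load))) => //.
rewrite sem_load; set l2 := (X in regs X).
pose l1 := take 19 l2.
(* From register 19 on, the only nonzero content can be the input of [p], which makes this an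
   initial configuration of the relocated copy. *)
have -> : (off_load + csize cmd_load, regs l2) =
    relocate_config 19 off_p p l1 (init (run_ops x (seed x y))).
  rewrite /relocate_config min0n addn0; congr (_, _); apply: funext => q.
  rewrite /stack_regs; case: ltnP => [ltq|leq]; first by rewrite nth_take.
  case: (ltngtP q 19) leq => // [ltq _|-> _ //].
  by rewrite /= subn_eq0 leqNgt ltq /regs nth_default.
apply: (iff_trans (reaches_halts (reaches_relocate occurs_p l1 _ k))).
move: hk out; set c := iter k _ _; case: c => pc rs /=.
rewrite /halted /= /relocate_config /= => hk <- /=.
rewrite (minn_idPr hk) -/off_end; set rr := stack_regs _ _ _.
have r19 : rr 19 = rs 0 by [].
have r18 : rr 18 = 0 by [].
case E: (rs 0) => [|w].
  split=> // _; apply/(reaches_halts (d := (off_end.+2, rr))).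
    apply: reaches_step (reaches_refl _ _).
    by rewrite (step_at0 _ occurs_end) //= r19 E.
  by apply: halts_halted; rewrite /halted size_diag.
split=> // /(reaches_halts (d := (off_end.+1, set_reg rr 19 w))) h; exfalso.
apply: (@stuck diag off_end.+1 18 (set_reg rr 19 w)) => //.
  by have := @occurs_catr _ _ [:: _] _ occurs_end; rewrite addn1.
apply: h; apply: reaches_step (reaches_refl _ _).
by rewrite (step_at0 _ occurs_end) //= r19 E.
Qed.

End Diagonal.

(** * Growth rates *)

Section GrowthRates.
Local Open Scope classical_set_scope.
Local Open Scope ring_scope.
Variable R : realType.
Implicit Types (l m c : R).

(** The ratio [l / m] is below 1, so its powers absorb any constant; hence constants do not affect
    growth rates. *)
Lemma eventually_geometric_le c l m : 0 < l -> l < m ->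
  exists n0, forall n, (n0 <= n)%N -> c * l ^+ n <= m ^+ n.
Proof.
move=> l0 lm.
have m0 : 0 < m := lt_trans l0 lm.
have : (fun n => c * (l / m) ^+ n) @ \oo --> (0 : R).
  apply: cvg_geometric; rewrite ger0_norm ?divr_ge0 ?ltW //.
  by rewrite ltr_pdivrMr // mul1r.
move=> /cvgr_le /(_ 1 ltr01) [n0 _ h]; exists n0 => n /h /=.
rewrite expr_div_n mulrA ler_pdivrMr ?exprn_gt0 // mul1r.
exact.
Qed.

Definition growth (u : nat -> R) : \bar R :=
  limn_esup (fun k => (u k.+1 `^ (k.+1%:R^-1))%:E).

Lemma powR_exprV m k : 0 <= m -> (m ^+ k.+1) `^ (k.+1%:R^-1) = m.
Proof.
by move=> m0; rewrite -powR_mulrn // -powRrM divff ?pnatr_eq0 // powRr1.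
Qed.

Lemma growth_le u c l m : 0 < l -> l < m -> (forall n, 0 <= u n.+1 <= c * l ^+ n.+1) ->
  (growth u <= m%:E)%E.
Proof.
move=> l0 lm h; have [n0 hn0] := eventually_geometric_le c l0 lm.
have m0 : 0 < m := lt_trans l0 lm.
rewrite /growth limn_esup_lim; apply: lime_le; first exact: is_cvg_esups.
exists n0 => // n /= le_n; apply: ge_ereal_sup => _ [k /= le_k <-].
rewrite lee_fin.
suff : u k.+1 `^ (k.+1%:R^-1) <= (m ^+ k.+1) `^ (k.+1%:R^-1).
  by rewrite powR_exprV // ltW.
apply: ge0_ler_powR; rewrite ?nnegrE //.
- by case/andP: (h k).
- by rewrite exprn_ge0 // ltW.
- case/andP: (h k) => _ /le_trans; apply; apply: hn0.
  by rewrite (leq_trans le_n) // ltnW.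
Qed.

Lemma growth_ge u c l : 0 < c -> 0 < l -> (forall n, c * l ^+ n <= u n) ->
  (l%:E <= growth u)%E.
Proof.
move=> c0 l0 h; rewrite /growth limn_esup_lim.
suff hm m : 0 < m -> m < l ->
    (m%:E <= limn (esups (fun k => (u k.+1 `^ (k.+1%:R^-1))%:E)))%E.
  apply/lee_subgt0Pr => d d0.
  have [dl|ld] := ltP d l.
    by rewrite -EFinB; apply: hm; rewrite ?subr_gt0 // ltrBlDr ltrDl.
  (* Here [l - d] is not positive, so any positive rate below [l] will do. *)
  apply: le_trans (hm (l / 2) _ _); last 2 first.
  - by rewrite divr_gt0.
  - by lra.
  by rewrite lee_fin; lra.
move=> m0 ml; have [n0 hn0] := eventually_geometric_le c^-1 m0 ml.
apply: lime_ge; first exact: is_cvg_esups.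
(* Each tail supremum dominates its first term. *)
near=> n; apply: le_ereal_sup_tmp.
exists (u n.+1 `^ (n.+1%:R^-1))%:E; first by exists n => /=.
rewrite lee_fin.
have hu : m ^+ n.+1 <= u n.+1.
  apply: le_trans (h n.+1); rewrite -ler_pdivrMl //; apply: hn0.
  by apply: leqW; near: n; exists n0.
suff : (m ^+ n.+1) `^ (n.+1%:R^-1) <= u n.+1 `^ (n.+1%:R^-1).
  by rewrite powR_exprV // ltW.
apply: ge0_ler_powR; rewrite ?nnegrE //.
  by rewrite exprn_ge0 // ltW.
by apply: ltW; apply: lt_le_trans hu; rewrite exprn_gt0.
Unshelve. all: by end_near. Qed.

End GrowthRates.

(** * The game of a program *)

(** [GeA] and [GeB] do not mention the thresholds, which enter the game only through the start
    vector; so Adam's matrices do not depend on them. *)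
Inductive label : Type :=
  | Incr of nat | Decr of nat | Zero of nat | GeA | GeB | Halt.

Record move := Move { src : nat; tgt : nat; lbl : label }.

(* Coordinates of the vector that a play transforms.  At round k, in a
   configuration with control state s and counters c_j, and up to a common
   factor, they are U j = 2^(k - c_j), V j = 2^(k + c_j),
   St q = [q = s] 2^k, Al = 2^(k + a - c_0) and Be = 2^(k + b - c_1).
   W, which exists only between the two moves of a round, is the part that Eve
   can make the players restart from. *)
Inductive comp : Type :=
  | U of nat | V of nat | St of nat | Al | Be | W.

HB.instance Definition _ := gen_eqMixin label.
HB.instance Definition _ := gen_eqMixin move.

(** The factor 2 of a round, times 2 or 1/2 if counter [j] changes. [Al] and [Be] scale like the
    coordinates [U] of counters 0 and 1. *)
Definition up (l : label) (j : nat) : nat :=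
  match l with
  | Incr r => if j == r then 1 else 2
  | Decr r => if j == r then 4 else 2
  | Halt => 0
  | _ => 2
  end.

Definition down (l : label) (j : nat) : nat :=
  match l with
  | Incr r => if j == r then 4 else 2
  | Decr r => if j == r then 1 else 2
  | Halt => 0
  | _ => 2
  end.

(* The weight of W is at most 1 if the move is legal (this is 2^c_r for the
   test c_r = 0, and 2 * 2^(- c_r) for a decrement), and at least 2
   otherwise. *)
Definition weight (m : move) (c c' : comp) : nat :=
  match c, c' with
  | U j, U k => (j == k) * up (lbl m) k
  | V j, V k => (j == k) * down (lbl m) k
  | Al, Al => up (lbl m) 0
  | Be, Be => up (lbl m) 1
  | St q, St q' =>
      if lbl m is Halt then 0 else (q == src m) * (q' == tgt m).*2
  | St q, W => if q == src m then (if lbl m is Halt then 1 else 0) else 2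
  | U j, W => if lbl m is Decr r then (j == r).*2 else 0
  | V j, W => if lbl m is Zero r then j == r else 0
  | Al, W => if lbl m is GeA then 1 else 0
  | Be, W => if lbl m is GeB then 1 else 0
  | _, _ => 0
  end.

(** * Indexing of the coordinates *)

Section Layout.
Variables (C S : nat).

Definition dim := (C + C + S).+2.

(** [W] comes last, so one numbering serves both the [dim] coordinates between rounds and the
    [dim.+1] within a round. *)
Definition comp_of (i : nat) : comp :=
  if i < C then U i else if i < C + C then V (i - C)
  else if i < C + C + S then St (i - (C + C))
  else if i == C + C + S then Al else if i == (C + C + S).+1 then Be else W.

Definition index_of (c : comp) : nat :=
  match c with
  | U j => j
  | V j => C + j
  | St q => C + C + q
  | Al => C + C + S
  | Be => (C + C + S).+1
  | W => dim
  end.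

Definition valid (c : comp) : bool :=
  match c with U j | V j => j < C | St q => q < S | _ => true end.

Lemma index_ofK c : valid c -> comp_of (index_of c) = c.
Proof.
case: c => [j|j|q||| ] /=; rewrite /comp_of.
- by move=> ->.
- move=> h; rewrite ltnNge leq_addr ltn_add2l h /=.
  by congr V; lia.
- move=> h; have -> : (C + C + q < C) = false by lia.
  have -> : (C + C + q < C + C) = false by lia.
  by rewrite ltn_add2l h /=; congr St; lia.
- move=> _; have -> : (C + C + S < C) = false by lia.
  have -> : (C + C + S < C + C) = false by lia.
  by rewrite ltnn eqxx.
- move=> _; have -> : ((C + C + S).+1 < C) = false by lia.
  have -> : ((C + C + S).+1 < C + C) = false by lia.
  have -> : ((C + C + S).+1 < C + C + S) = false by lia.
  have -> : ((C + C + S).+1 == C + C + S) = false by lia.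
  by rewrite eqxx.
- move=> _; rewrite /dim; have -> : ((C + C + S).+2 < C) = false by lia.
  have -> : ((C + C + S).+2 < C + C) = false by lia.
  have -> : ((C + C + S).+2 < C + C + S) = false by lia.
  have -> : ((C + C + S).+2 == C + C + S) = false by lia.
  by have -> : ((C + C + S).+2 == (C + C + S).+1) = false by lia.
Qed.

Lemma index_of_lt c : valid c -> c <> W -> index_of c < dim.
Proof. by case: c => [j|j|q||| ] //=; rewrite /dim; lia. Qed.

Lemma comp_of_valid i : valid (comp_of i).
Proof.
rewrite /comp_of; case: ifP => // h1; case: ifP => [h2|h2] /=; first by lia.
by case: ifP => [h3|_] /=; [lia | case: ifP => // _; case: ifP].
Qed.

Lemma comp_ofK i : i <= dim -> index_of (comp_of i) = i.
Proof.
rewrite /comp_of /dim => h0.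
do 5 (case: ifP => /=; [by lia|move=> ?]); rewrite /dim; lia.
Qed.

Lemma comp_of_inj i j : i <= dim -> j <= dim -> comp_of i = comp_of j -> i = j.
Proof. by move=> hi hj /(congr1 index_of); rewrite !comp_ofK. Qed.

Lemma comp_of_dim : comp_of dim = W.
Proof. exact: (@index_ofK W). Qed.

Lemma comp_of_neqW i : i < dim -> comp_of i <> W.
Proof.
move=> lt_i; rewrite -comp_of_dim => /comp_of_inj E.
by have := E (ltnW lt_i) (leqnn _); lia.
Qed.

Definition adam_mx (m : move) : 'M[nat]_(dim, dim.+1) :=
  \matrix_(i, j) weight m (comp_of i) (comp_of j).

Definition pass_mx : 'M[nat]_(dim.+1, dim) := \matrix_(i, j) nat_of_bool (i == j :> nat).

(** A matrix of rank at most one: a row vector is sent to its [W] entry times [w]. *)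
Definition restart_mx (w : comp -> nat) : 'M[nat]_(dim.+1, dim) :=
  \matrix_(i, j) if i == dim :> nat then w (comp_of j) else 0.

End Layout.

(** States up to [size P] are program addresses, with [size P] for halting; the two further ones are
    for guessing and for the second claim. *)
Definition guess_state (P : program) : nat := (size P).+1.

Definition instr_moves (P : program) (i : nat) : seq move :=
  match nth (Inc 0) P i with
  | Inc r => [:: Move i i.+1 (Incr r)]
  | Dec r l => [:: Move i i.+1 (Decr r); Move i (minn l (size P)) (Zero r)]
  end.

(* In the guess state Adam increases counters 0 and 1 at will; he then claims
   c_0 >= a and c_1 >= b, and runs the program. *)
Definition guess_moves (P : program) : seq move :=
  let g := guess_state P in
  [:: Move g g (Incr 0); Move g g (Incr 1); Move g g.+1 GeA; Move g.+1 0 GeB;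
      Move (size P) 0 Halt].

Definition moves (P : program) : seq move :=
  guess_moves P ++ flatten [seq instr_moves P i | i <- iota 0 (size P)].

Definition nstates (P : program) : nat := (size P + 3).

Definition start_weight (P : program) (a b : nat) (c : comp) : nat :=
  match c with
  | U _ | V _ => 1
  | St q => q == guess_state P
  | Al => 2 ^ a
  | Be => 2 ^ b
  | W => 0
  end.

Definition game (P : program) (C a b : nat) : nat_mmg :=
  @NatMMG (dim C (nstates P)) (dim C (nstates P)).+1
    [seq adam_mx C (nstates P) m | m <- moves P]
    [:: pass_mx C (nstates P);
        restart_mx C (nstates P) (start_weight P a b)] isT isT isT isT.

Definition reg_of (i : instr) : nat := match i with Inc r | Dec r _ => r end.

(** [Halt] counts as not legal, so legal runs stop just before it and it is treated apart. *)
Definition legal (a b : nat) (l : label) (rs : nat -> nat) : bool :=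
  match l with
  | Decr r => 0 < rs r
  | Zero r => rs r == 0
  | GeA => a <= rs 0
  | GeB => b <= rs 1
  | Halt => false
  | Incr _ => true
  end.

Definition update (l : label) (rs : nat -> nat) : nat -> nat :=
  match l with
  | Incr r => set_reg rs r (rs r).+1
  | Decr r => set_reg rs r (rs r).-1
  | _ => rs
  end.

Definition lbl_ok (C : nat) (l : label) : bool :=
  match l with Incr r | Decr r | Zero r => r < C | _ => true end.

Definition move_ok (C S : nat) (m : move) : bool :=
  [&& src m < S, tgt m < S & lbl_ok C (lbl m)].

Lemma moves_ok P C : 1 < C -> all (fun i => reg_of i < C) P ->
  all (move_ok C (nstates P)) (moves P).
Proof.
move=> C1 hP; apply/allP => m; rewrite mem_cat => /orP[|/flattenP[s /mapP[i]]].
  have h : all (move_ok C (nstates P)) (guess_moves P).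
    rewrite /= /move_ok /= /guess_state /nstates !andbT (ltnW C1) C1; lia.
  by move/(allP h).
rewrite mem_iota add0n => /= lt_i ->; rewrite /instr_moves.
have := all_nthP (Inc 0) hP _ lt_i.
case: (nth _ P i) => [r|r l] /= ltr; rewrite !inE.
  by move=> ->; rewrite /move_ok /= ltr /nstates; lia.
by case/orP => /eqP ->; rewrite /move_ok /= ltr /nstates; lia.
Qed.

Lemma halt_src P m : m \in moves P -> lbl m = Halt -> src m = size P.
Proof.
rewrite mem_cat => /orP[|/flattenP[s /mapP[i _ ->]]].
  by rewrite !inE => /or4P[|||/orP[]] /eqP ->.
rewrite /instr_moves; case: (nth _ P i) => [r|r l]; rewrite !inE.
  by move=> ->.
by case/orP => /eqP ->.
Qed.

(** * Effect of one round on an encoded configuration *)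

Section Dynamics.
Local Open Scope ring_scope.
Variables (R : realType) (C S a b : nat).
Implicit Types (cf : config) (m : move).

(** The vector with the scale [2^k] divided out, so that a legal round that is passed multiplies it
    by exactly 2. *)
Definition enc cf (c : comp) : R :=
  match c with
  | U j => 2^-1 ^+ cf.2 j
  | V j => 2 ^+ cf.2 j
  | St q => (q == cf.1)%:R
  | Al => 2 ^+ a * 2^-1 ^+ cf.2 0%N
  | Be => 2 ^+ b * 2^-1 ^+ cf.2 1%N
  | W => 0
  end.

Lemma enc_ge0 cf c : 0 <= enc cf c.
Proof.
by case: c => [j|j|q||| ] //=; rewrite ?mulr_ge0 ?exprn_ge0 ?invr_ge0 ?ler0n.
Qed.

Definition next m cf : config := (tgt m, update (lbl m) cf.2).

Lemma up_legal l (rs : nat -> nat) j : legal a b l rs ->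
  2^-1 ^+ rs j * (up l j)%:R = 2 * 2^-1 ^+ update l rs j :> R.
Proof.
case: l => [r|r|r|||] //= h; rewrite ?[_ * 2]mulrC // /set_reg.
  by case: eqP => [->|_]; rewrite 1?exprS; field.
case: eqP => [->|_]; last by rewrite mulrC.
by case: (rs r) h => // v _; rewrite exprS /=; field.
Qed.

Lemma down_legal l (rs : nat -> nat) j : legal a b l rs ->
  2 ^+ rs j * (down l j)%:R = 2 * 2 ^+ update l rs j :> R.
Proof.
case: l => [r|r|r|||] //= h; rewrite ?[_ * 2]mulrC // /set_reg.
  by case: eqP => [->|_]; rewrite 1?exprS; ring.
case: eqP => [->|_]; last by rewrite mulrC.
by case: (rs r) h => // v _; rewrite exprS /=; ring.
Qed.

(** Every column other than [W] has at most one nonzero weight, so the update of a coordinate is a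
    single product. *)
Lemma weight_next m cf c' : (src m < S)%N -> valid C S c' -> c' <> W ->
  src m = cf.1 -> legal a b (lbl m) cf.2 ->
  exists c0, [/\ valid C S c0, c0 <> W, forall c, c <> c0 -> weight m c c' = 0%N
    & enc cf c0 * (weight m c0 c')%:R = 2 * enc (next m cf) c'].
Proof.
move=> srcS vc' nW Esrc leg; case: c' vc' nW => [k|k|q'||| //] vc' _.
- exists (U k); split=> //=; last by rewrite eqxx mul1n up_legal.
  by case=> [j|j|q||| ] //= ne; case: eqP => // E; case: ne; rewrite E.
- exists (V k); split=> //=; last by rewrite eqxx mul1n down_legal.
  by case=> [j|j|q||| ] //= ne; case: eqP => // E; case: ne; rewrite E.
- exists (St (src m)); split=> //=.
    case=> [j|j|q||| ] //= ne; case: (q =P src m) => [E|_].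
      by case: ne; rewrite E.
    by case: (lbl m).
  rewrite Esrc !eqxx mul1r.
  by case: (lbl m) leg => // *; rewrite mul1n -mul2n natrM.
- by exists Al; split=> //= [[]//|]; rewrite -mulrA up_legal // mulrCA.
- by exists Be; split=> //= [[]//|]; rewrite -mulrA up_legal // mulrCA.
Qed.

(** Wrong states have weight 2 in column [W] but no mass in [enc], so only the stake of the test, or
    of [Halt], remains. *)
Lemma weight_W_le1 m cf : src m = cf.1 ->
  legal a b (lbl m) cf.2 \/ lbl m = Halt ->
  exists c0, (forall c, c <> c0 -> enc cf c * (weight m c W)%:R = 0) /\
    enc cf c0 * (weight m c0 W)%:R <= 1.
Proof.
move=> Esrc leg.
have half_le1 (x k : nat) : (x <= k)%N -> 2 ^+ x * 2^-1 ^+ k <= 1 :> R.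
  move=> le_xk; rewrite exprVn ler_pdivrMr ?exprn_gt0 // mul1r.
  by rewrite ler_eXn2l // ltr1n.
have StW q : lbl m <> Halt \/ q <> src m ->
    enc cf (St q) * (weight m (St q) W)%:R = 0.
  rewrite /= -Esrc; case: eqP => [Eq|_]; last by rewrite mul0r.
  by case=> // H; case: (lbl m) H; rewrite ?mulr0.
case E: (lbl m) leg => [r|r|r|||] leg.
- exists (St (src m)); split; last by rewrite /= E eqxx mulr0.
  case=> [j|j|q||| ] ne; rewrite ?StW //= ?E ?mulr0 //; by left.
- exists (U r); split.
    case=> [j|j|q||| ] ne; rewrite ?StW //= ?E ?mulr0 //; last by left.
    by case: eqP => [Ejr|]; rewrite ?mulr0 //; case: ne; rewrite Ejr.
  rewrite /= E eqxx mulrC -[X in X * _]expr1; apply: half_le1.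
  by case: leg.
- exists (V r); split.
    case=> [j|j|q||| ] ne; rewrite ?StW //= ?E ?mulr0 //; last by left.
    by case: eqP => [Ejr|]; rewrite ?mulr0 //; case: ne; rewrite Ejr.
  by case: leg => // /eqP /= ->; rewrite /= E eqxx mulr1.
- exists Al; split.
    case=> [j|j|q||| ] ne; rewrite ?StW //= ?E ?mulr0 //; by left.
  by rewrite /= E mulr1; apply: half_le1; case: leg.
- exists Be; split.
    case=> [j|j|q||| ] ne; rewrite ?StW //= ?E ?mulr0 //; by left.
  by rewrite /= E mulr1; apply: half_le1; case: leg.
- exists (St (src m)); split; last by rewrite /= E eqxx mulr1 Esrc eqxx.
  case=> [j|j|q||| ] ne; rewrite ?StW //= ?E ?mulr0 //; right=> Eq.
  by case: ne; rewrite Eq.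
Qed.

(** A move from a wrong state stakes twice the current state. A failed test is off by at least one
    unit, so its power of 2 is at least 2. *)
Lemma weight_W_ge2 m cf : (1 < C)%N -> (cf.1 < S)%N -> lbl_ok C (lbl m) ->
  src m <> cf.1 \/ ~~ legal a b (lbl m) cf.2 /\ lbl m <> Halt ->
  exists c0, [/\ valid C S c0, c0 <> W & 2 <= enc cf c0 * (weight m c0 W)%:R].
Proof.
move=> C1 cfS ok [ne|[]].
  exists (St cf.1); split=> //=; rewrite eqxx mul1r eq_sym.
  by case: eqP.
have half_ge2 (x k : nat) : (k < x)%N -> 2 <= 2 ^+ x * 2^-1 ^+ k :> R.
  move=> lt_kx; rewrite exprVn ler_pdivlMr ?exprn_gt0 // -exprS.
  by rewrite ler_eXn2l // ltr1n.
case E: (lbl m) ok => [r|r|r|||] // ok leg _.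
- exists (U r); split=> //=; rewrite E eqxx mulrC -[X in X * _]expr1.
  by apply: half_ge2; rewrite ltnS leqNgt.
- exists (V r); split=> //=; rewrite E eqxx mulr1.
  by rewrite -[X in X <= _]expr1 ler_eXn2l ?ltr1n // lt0n.
- by exists Al; split=> //=; rewrite E mulr1 half_ge2 // ltnNge.
- by exists Be; split=> //=; rewrite E mulr1 half_ge2 // ltnNge.
Qed.

Definition adam_R m : 'M[R]_(dim C S, (dim C S).+1) :=
  map_mx (fun x : nat => x%:R) (adam_mx C S m).

Definition pass_R : 'M[R]_((dim C S).+1, dim C S) :=
  map_mx (fun x : nat => x%:R) (pass_mx C S).

Definition restart_R (w : comp -> nat) : 'M[R]_((dim C S).+1, dim C S) :=
  map_mx (fun x : nat => x%:R) (restart_mx C S w).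

Lemma pass_R_E (z : 'rV[R]_(dim C S).+1) (j : 'I_(dim C S)) :
  (z *m pass_R) 0 j = z 0 (widen_ord (leqnSn _) j).
Proof.
rewrite mxE (bigD1 (widen_ord (leqnSn _) j)) //= !mxE eqxx mulr1 big1 ?addr0 //.
move=> i ne; rewrite !mxE; case: eqP => [E|]; rewrite ?mulr0 //.
by case/eqP: ne; apply: val_inj.
Qed.

Lemma restart_R_E (w : comp -> nat) (z : 'rV[R]_(dim C S).+1) (j : 'I_(dim C S)) :
  (z *m restart_R w) 0 j = z 0 ord_max * (w (comp_of C S j))%:R.
Proof.
rewrite mxE (bigD1 ord_max) //= !mxE eqxx big1 ?addr0 //.
move=> i ne; rewrite !mxE; case: eqP => [E|]; rewrite ?mulr0 //.
by case/eqP: ne; apply: val_inj.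
Qed.

Lemma adam_ge (y : 'rV[R]_(dim C S)) (B : R) cf m c0 (j : 'I_(dim C S).+1) :
  0 <= B ->
  valid C S c0 -> c0 <> W ->
  (forall i : 'I_(dim C S), B * enc cf (comp_of C S i) <= y 0 i) ->
  B * (enc cf c0 * (weight m c0 (comp_of C S j))%:R) <= (y *m adam_R m) 0 j.
Proof.
move=> B0 vc0 nW hy.
have y0 i : 0 <= y 0 i.
  by apply: le_trans (hy i); rewrite mulr_ge0 ?enc_ge0.
rewrite mxE (bigD1 (Ordinal (index_of_lt vc0 nW))) //= !mxE /= index_ofK //.
rewrite -[X in X <= _]addr0 lerD //.
  rewrite mulrA ler_wpM2r //; apply: le_trans (hy _).
  by rewrite /= index_ofK.
by rewrite sumr_ge0 // => i _; rewrite mulr_ge0 // !mxE.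
Qed.

Lemma adam_le (y : 'rV[R]_(dim C S)) (B : R) cf m c0 (j : 'I_(dim C S).+1) :
  0 <= B ->
  (forall c, c <> c0 -> enc cf c * (weight m c (comp_of C S j))%:R = 0) ->
  (forall i : 'I_(dim C S), y 0 i <= B * enc cf (comp_of C S i)) ->
  (y *m adam_R m) 0 j <= B * (enc cf c0 * (weight m c0 (comp_of C S j))%:R).
Proof.
move=> B0 hc0 hy; rewrite mxE.
have hle i : y 0 i * adam_R m i j <=
    B * (enc cf (comp_of C S i) * (weight m (comp_of C S i) (comp_of C S j))%:R).
  by rewrite [adam_R m i j]mxE [adam_mx _ _ _ _ _]mxE mulrA ler_wpM2r.
(* [c0] need not name a coordinate; if it does not, all terms are at most 0. *)
have [[i0 Ei0]|no] := pselect (exists i : 'I_(dim C S), comp_of C S i = c0).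
  rewrite (bigD1 i0) //= -Ei0 -[leRHS]addr0 lerD //.
  apply: sumr_le0 => i ne; apply: le_trans (hle i) _.
  rewrite hc0 ?mulr0 // -Ei0 => /comp_of_inj E; case/eqP: ne; apply: val_inj.
  by apply: E; apply: ltnW.
apply: (@le_trans _ _ 0).
  apply: sumr_le0 => i _; apply: le_trans (hle i) _.
  by rewrite hc0 ?mulr0 // => E; apply: no; exists i.
by rewrite mulr_ge0 // mulr_ge0 // enc_ge0.
Qed.

End Dynamics.

(** * Legal runs *)

Section SlowRate.
Local Open Scope ring_scope.

(** A cycle of [i] doublings and one round without gain. With [l = 2 (1 - x)] and
    [x = 1 / (2 (T + 1))], Bernoulli's inequality bounds [(1 - x)^(i + 1)] below by 1/2. *)
Lemma slow_rate (R : realType) (T : nat) :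
  exists l : R, [/\ 1 <= l, l < 2 &
    forall i, (i <= T)%N -> 2 ^+ i <= l ^+ i.+1].
Proof.
pose x : R := (2 * T.+1%:R)^-1.
have x0 : 0 < x by rewrite invr_gt0 mulr_gt0 // ltr0n.
have Tx : T.+1%:R * x = 2^-1.
  by rewrite /x invfM mulrCA divff ?mulr1 // pnatr_eq0.
have x12 : x <= 2^-1.
  by rewrite -Tx ler_peMl ?ler1n // ltW.
have bern n : 1 - n%:R * x <= (1 - x) ^+ n.
  elim: n => [|n IHn]; first by rewrite mul0r subr0.
  have n0 : 0 <= n%:R :> R by [].
  have h0 : 0 <= 1 - x by lra.
  rewrite exprS; apply: le_trans (ler_wpM2l h0 IHn).
  by rewrite -natr1; nra.
exists (2 * (1 - x)); split; [lra|lra|] => i le_iT.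
rewrite exprMn exprS -mulrA mulrCA ler_peMr ?exprn_ge0 //.
have := bern i.+1.
have : i.+1%:R * x <= T.+1%:R * x by rewrite ler_wpM2r ?ler_nat // ltW.
rewrite Tx; lra.
Qed.

End SlowRate.

(** * Legal runs and their invariant *)

Section Runs.
Variables (P : program) (a b : nat).

Definition start : config := (guess_state P, regs [::]).

Fixpoint run (ms : seq move) (cf : config) : Prop :=
  if ms is m :: ms' then
    [/\ m \in moves P, src m = cf.1, legal a b (lbl m) cf.2 &
        run ms' (next m cf)]
  else True.

Definition final (ms : seq move) (cf : config) : config :=
  foldl (fun cf m => next m cf) cf ms.

Definition can_reach (cf cf' : config) : Prop :=
  exists2 ms, run ms cf & final ms cf = cf'.

Lemma can_reach_refl cf : can_reach cf cf.
Proof. by exists [::]. Qed.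

Lemma can_reach_step m cf cf' : m \in moves P -> src m = cf.1 ->
  legal a b (lbl m) cf.2 -> can_reach (next m cf) cf' -> can_reach cf cf'.
Proof. by move=> mP sm lm [ms rms fms]; exists (m :: ms). Qed.

Lemma can_reach_trans cf1 cf2 cf3 :
  can_reach cf1 cf2 -> can_reach cf2 cf3 -> can_reach cf1 cf3.
Proof.
move=> [ms]; elim: ms cf1 => [|m ms IHms] cf1 /=; first by move=> _ ->.
move=> [mP sm lm rms] fms h; apply: can_reach_step mP sm lm _.
exact: IHms rms fms h.
Qed.

Lemma guess_moves_in i : i < 5 ->
  nth (Move 0 0 Halt) (guess_moves P) i \in moves P.
Proof. by move=> lt_i; rewrite mem_cat mem_nth. Qed.

Lemma instr_moves_in i m : i < size P -> m \in instr_moves P i -> m \in moves P.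
Proof.
move=> lt_i hm; rewrite mem_cat; apply/orP; right; apply/flattenP.
by exists (instr_moves P i) => //; apply/mapP; exists i; rewrite ?mem_iota.
Qed.

(** All halting addresses become the state [size P], in accordance with the truncated jump targets
    of [instr_moves]. *)
Definition clip (c : config) : config := (minn c.1 (size P), c.2).

Lemma can_reach_clip k c : can_reach (clip c) (clip (iter k (step P) c)).
Proof.
elim: k c => [|k IHk] c; first exact: can_reach_refl.
rewrite iterSr; apply: can_reach_trans (IHk _).
case: c => pc rs; rewrite /step /halted /=; case: leqP => [_|lt_pc].
  exact: can_reach_refl.
have in_moves := @instr_moves_in pc _ lt_pc.
rewrite /clip /= (minn_idPl (ltnW lt_pc)).
move: in_moves; rewrite /instr_moves; case: (nth _ P pc) => [r|r l] in_moves /=.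
  apply: (can_reach_step (in_moves _ (mem_head _ _))) => //.
  by rewrite /next /= (minn_idPl lt_pc); apply: can_reach_refl.
case E: (rs r) => [|v].
  apply: (@can_reach_step (Move pc (minn l (size P)) (Zero r))) => //=.
  - by apply: in_moves; rewrite in_cons mem_head orbT.
  - by rewrite E.
  exact: can_reach_refl.
apply: (can_reach_step (in_moves _ (mem_head _ _))) => //=; first by rewrite E.
by rewrite /next /= E (minn_idPl lt_pc); apply: can_reach_refl.
Qed.

Lemma can_reach_guess x y :
  can_reach start (guess_state P, regs [:: x; y]).
Proof.
have h0 : start = (guess_state P, regs [:: 0; 0]).
  by rewrite /start -(regs_pad [::] 2).
rewrite h0; apply: (@can_reach_trans _ (guess_state P, regs [:: x; 0])).
  elim: x => [|x IHx]; first exact: can_reach_refl.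
  apply: can_reach_trans IHx _.
  apply: (@can_reach_step (Move (guess_state P) (guess_state P) (Incr 0))) => //.
    exact: (@guess_moves_in 0).
  rewrite -[next _ _]/(guess_state P, set_reg (regs [:: x; 0]) 0 x.+1).
  by rewrite set_regs //; apply: can_reach_refl.
elim: y => [|y IHy]; first exact: can_reach_refl.
apply: can_reach_trans IHy _.
apply: (@can_reach_step (Move (guess_state P) (guess_state P) (Incr 1))) => //.
  exact: (@guess_moves_in 1).
rewrite -[next _ _]/(guess_state P, set_reg (regs [:: x; y]) 1 y.+1).
by rewrite set_regs //; apply: can_reach_refl.
Qed.

Lemma can_reach_halting x y : a <= x -> b <= y ->
  halts P (0, regs [:: x; y]) -> exists rs, can_reach start (size P, rs).
Proof.
move=> le_ax le_by [k hk].
have := can_reach_clip k (0, regs [:: x; y]).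
move: hk; case: (iter k _ _) => pc rs; rewrite /halted /clip /= => hk.
rewrite (minn_idPr hk) min0n => h; exists rs.
apply: can_reach_trans (can_reach_guess x y) _.
apply: (@can_reach_step (Move (guess_state P) (guess_state P).+1 GeA)) => //.
  exact: (@guess_moves_in 2).
apply: (@can_reach_step (Move (guess_state P).+1 0 GeB)) => //.
exact: (@guess_moves_in 3).
Qed.

(** The invariant of legal play: a run of the program remembers initial values that satisfy both
    claims. *)
Inductive reachable : config -> Prop :=
  | ReachGuess x y : reachable (guess_state P, regs [:: x; y])
  | ReachGuess1 x y : a <= x -> reachable ((guess_state P).+1, regs [:: x; y])
  | ReachRun x y k : a <= x -> b <= y ->
      reachable (clip (iter k (step P) (0, regs [:: x; y]))).

Lemma reachable_start : reachable start.
Proof. by have := ReachGuess 0 0; rewrite -[[:: 0; 0]]/([::] ++ nseq 2 0) regs_pad. Qed.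

(** The machine is deterministic and its tests are checked, so the only legal move at an address is
    its step. *)
Lemma reachable_next m cf : m \in moves P -> src m = cf.1 ->
  legal a b (lbl m) cf.2 -> reachable cf -> reachable (next m cf).
Proof.
move=> mP Esrc leg rcf; move: mP; rewrite mem_cat => /orP[|/flattenP[s /mapP[i]]].
  rewrite !inE => mP; case: rcf Esrc leg => [x y|x y le_ax|x y k le_ax le_by].
  - case/or4P: mP => [|||/orP[]] /eqP -> //=; rewrite /guess_state; try lia.
    + move=> _ _; rewrite -[next _ _]/(guess_state P, set_reg (regs [:: x; y]) 0 x.+1).
      by rewrite set_regs //; apply: ReachGuess.
    + move=> _ _; rewrite -[next _ _]/(guess_state P, set_reg (regs [:: x; y]) 1 y.+1).
      by rewrite set_regs //; apply: ReachGuess.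
    + by move=> _ le_ax; apply: ReachGuess1.
  - case/or4P: mP => [|||/orP[]] /eqP -> //=; rewrite /guess_state; try lia.
    move=> _ le_by; have := ReachRun 0 le_ax le_by.
    by rewrite /clip /= min0n.
  - have := geq_minr (iter k (step P) (0, regs [:: x; y])).1 (size P).
    case/or4P: mP => [|||/orP[]] /eqP -> //=; rewrite /guess_state; lia.
rewrite mem_iota add0n => /= lt_i -> mP.
have src_i : src m = i.
  move: mP; rewrite /instr_moves; case: (nth _ P i) => [r|r l]; rewrite !inE.
    by move=> ->.
  by case/orP => /eqP ->.
rewrite src_i in Esrc.
case: rcf Esrc leg => [x y|x y _|x y k le_ax le_by] /=; rewrite /guess_state; try lia.
case E: (iter k _ _) => [pc rs] /=.
have [le_pc|lt_pc] := leqP (size P) pc; first lia.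
move=> Ei leg; have {Ei} Ei : i = pc by lia.
have := ReachRun k.+1 le_ax le_by; rewrite iterS E /step /halted /= leqNgt lt_pc /=.
move: mP; rewrite Ei /instr_moves; case: (nth _ P pc) => [r|r l]; rewrite !inE.
  by move=> ->; rewrite /clip /= (minn_idPl lt_pc).
case/orP => /eqP Em; move: leg; rewrite Em /=.
  case Er: (rs r) => [//|v] _.
  by rewrite /clip /next /= Er (minn_idPl lt_pc).
by move=> /eqP ->; rewrite /clip /next.
Qed.

Lemma reachable_lt cf : reachable cf -> cf.1 < nstates P.
Proof.
by case=> *; rewrite /= /guess_state /nstates; lia.
Qed.

Lemma reachable_halting cf : reachable cf -> cf.1 = size P ->
  exists x y, [/\ a <= x, b <= y & halts P (0, regs [:: x; y])].
Proof.
case=> [x y|x y _|x y k le_ax le_by] /=; rewrite /guess_state; [lia|lia|].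
by move=> E; exists x, y; split=> //; exists k; rewrite /halted; lia.
Qed.

End Runs.

(** * The value of the game *)

Section Value.
Local Open Scope ring_scope.
Variables (R : realType) (P : program) (C a b : nat).
Hypotheses (C_gt1 : (1 < C)%N)
  (regs_lt : all (fun i => reg_of i < C)%N P).

Let S := nstates P.
Let AS := real_moves R (adam_moves (game P C a b)).
Let ES := real_moves R (eve_moves (game P C a b)).
Let D := dim C S.
Let restart := restart_R R C S (start_weight P a b).

Lemma adam_moveP (X : AS) : {m | m \in moves P & val X = adam_R R C S m}.
Proof.
apply: cid2; case: X => X hX /=; have [Y hY <-] := set_mem hX.
have /mapP[m mP ->] : Y \in [seq adam_mx C S m | m <- moves P] by [].
by exists m.
Qed.

Lemma eve_moveP (X : ES) : val X = pass_R R C S \/ val X = restart.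
Proof.
case: X => X hX /=; have [Y hY <-] := set_mem hX.
have : Y \in [:: pass_mx C S; restart_mx C S (start_weight P a b)] by [].
by rewrite !inE => /orP[] /eqP ->; [left|right].
Qed.

Definition adam_play m (mP : m \in moves P) : AS :=
  SigSub (mem_set
    (ex_intro2 _ _ (adam_mx C S m) (map_f _ mP) erefl : AS (adam_R R C S m))).

Lemma pass_in : ES (pass_R R C S).
Proof. by exists (pass_mx C S) => //=; rewrite mem_head. Qed.

Lemma restart_in : ES restart.
Proof.
by exists (restart_mx C S (start_weight P a b)) => //=; rewrite !inE eqxx orbT.
Qed.

Lemma start_weightE j :
  (start_weight P a b (comp_of C S j))%:R = enc R a b (start P) (comp_of C S j).
Proof.
case: (comp_of C S j) => [k|k|q||| ] //=.
all: by rewrite ?natrX ?/regs ?nth_nil ?expr0 ?mulr1.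
Qed.

Section Play.
Variables (s : adam_strategy AS ES) (t : eve_strategy AS ES).

(** All entries are nonnegative, so the norm of the product is the sum of this row vector, and it
    suffices to follow one vector. *)
Definition colsum (k : nat) : 'rV[R]_D := const_mx 1 *m play_product s t k.

Lemma play_productS k : play_product s t k.+1 =
  play_product s t k *m
    (val (s (play s t k)) *m val (t (play s t k) (s (play s t k)))).
Proof. by rewrite /play_product /= -cats1 big_cat /= big_seq1. Qed.

Lemma colsumS k : colsum k.+1 = colsum k *m val (s (play s t k))
  *m val (t (play s t k) (s (play s t k))).
Proof. by rewrite /colsum play_productS !mulmxA. Qed.

Lemma colsum0 j : colsum 0 0 j = 1.
Proof. by rewrite /colsum /play_product big_nil mulmx1 mxE. Qed.

Lemma play_product_ge0 k i j : 0 <= play_product s t k i j.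
Proof.
elim: k i j => [|k IHk] i j; first by rewrite /play_product big_nil mxE.
rewrite play_productS mxE sumr_ge0 // => l _; rewrite mulr_ge0 // mxE.
rewrite sumr_ge0 // => n _; rewrite mulr_ge0 //.
  by have [m _ ->] := adam_moveP (s (play s t k)); rewrite !mxE.
by case: (eve_moveP (t (play s t k) (s (play s t k)))) => ->; rewrite !mxE.
Qed.

Lemma norm1_colsum k : norm1 (play_product s t k) = \sum_j colsum k 0 j.
Proof.
rewrite /norm1 exchange_big; apply: eq_bigr => j _.
rewrite /colsum mxE; apply: eq_bigr => i _.
by rewrite mxE mul1r ger0_norm // play_product_ge0.
Qed.

Lemma payoffE : payoff s t = growth (fun k => norm1 (play_product s t k)).
Proof. by []. Qed.

End Play.

(** * Eve ensures 2 if no admissible guess halts *)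

Section EveWins.
Hypothesis never : ~ exists x y,
  [/\ (a <= x)%N, (b <= y)%N & halts P (0%N, regs [:: x; y])].

(** Eve sees only a matrix; a fixed choice of a move for it lets her track the configuration. *)
Definition pick_move (X : AS) : move := s2val (adam_moveP X).

Lemma pick_moveP X : pick_move X \in moves P /\ val X = adam_R R C S (pick_move X).
Proof. by rewrite /pick_move; case: (adam_moveP X). Qed.

Definition fair m (cf : config) : bool :=
  (src m == cf.1) && legal a b (lbl m) cf.2.

Definition respond (cf : config) (X : AS) : config :=
  if fair (pick_move X) cf then next (pick_move X) cf else start P.

Definition track (h : history AS ES) : config :=
  foldl (fun cf r => respond cf r.1) (start P) h.

Definition police : eve_strategy AS ES := fun h X =>
  if fair (pick_move X) (track h) then SigSub (mem_set pass_in)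
  else SigSub (mem_set restart_in).

Lemma track_reachable h : reachable P a b (track h).
Proof.
rewrite /track; elim/last_ind: h => [|h r IHh]; first exact: reachable_start.
rewrite foldl_rcons /respond; case: ifP => [|_]; last exact: reachable_start.
case/andP=> /eqP Esrc leg.
by apply: reachable_next => //; case: (pick_moveP r.1).
Qed.

(** Each round gains a factor 2, from the legal step or from a stake of at least 2. The constant
    makes the initial all-ones vector dominate the entries [2^a] and [2^b] of the start vector. *)
Lemma colsum_police s k (j : 'I_D) :
  2 ^- (a + b) * 2 ^+ k * enc R a b (track (play s police k)) (comp_of C S j)
  <= colsum s police k 0 j.
Proof.
elim: k j => [|k IHk] j.
  rewrite colsum0 /track /= expr0 mulr1 -start_weightE.
  rewrite mulrC ler_pdivrMr ?exprn_gt0 // mul1r -natrX ler_nat.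
  have h1 : (1 <= 2 ^ (a + b))%N by rewrite expn_gt0.
  case: (comp_of C S j) => [i|i|q||| ] //=.
  - by case: eqP.
  - by rewrite leq_exp2l // leq_addr.
  - by rewrite leq_exp2l // leq_addl.
rewrite colsumS /= /track foldl_rcons -/(track _) /=.
set h := play s police k in IHk *; set X := s h.
have rcf := track_reachable h.
have [mP EX] := pick_moveP X; set m := pick_move X in mP EX.
have /and3P[srcS tgtS ok] := allP (moves_ok C_gt1 regs_lt) _ mP.
have B0 : 0 <= 2 ^- (a + b) * 2 ^+ k :> R.
  by rewrite mulr_ge0 ?invr_ge0 ?exprn_ge0.
have cfS : ((track h).1 < S)%N := reachable_lt rcf.
rewrite /police /respond -/m EX exprS.
case: ifP => [/andP[/eqP Esrc leg]|nfair] /=.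
  rewrite pass_R_E.
  have [c0 [vc0 nW _ E]] := weight_next R srcS (comp_of_valid C S j)
    (comp_of_neqW (ltn_ord j)) Esrc leg.
  apply: le_trans (@adam_ge R C S a b _ _ (track h) m c0
    (widen_ord (leqnSn D) j) B0 vc0 nW IHk) => /=.
  by rewrite E le_eqVlt; apply/orP; left; apply/eqP; ring.
rewrite restart_R_E start_weightE.
(* A [Halt] from the right state would exhibit a halting admissible guess. *)
have nleg : src m <> (track h).1 \/ ~~ legal a b (lbl m) (track h).2 /\ lbl m <> Halt.
  case: (src m =P (track h).1) => [Esrc|]; [right|by left].
  move: nfair; rewrite /fair Esrc eqxx /= => ->; split=> // EH.
  apply: never; apply: (reachable_halting rcf).
  by rewrite -Esrc (halt_src mP EH).
have [c0 [vc0 nW ge2]] := weight_W_ge2 R C_gt1 cfS ok nleg.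
have := @adam_ge R C S a b _ _ (track h) m c0 ord_max B0 vc0 nW IHk.
rewrite /= comp_of_dim => geW.
rewrite ler_wpM2r ?enc_ge0 //; apply: le_trans geW.
by rewrite mulrCA mulrC ler_wpM2l.
Qed.

Lemma eve_value_ge2 : (2%:E <= nat_mmg_value R (game P C a b))%E.
Proof.
apply: le_ereal_sup_tmp; exists (ereal_inf
  [set payoff s police | s in [set: adam_strategy AS ES]]%classic).
  by exists police.
apply: le_ereal_inf_tmp => _ [s _ <-]; rewrite payoffE.
apply: (@growth_ge _ _ (2 ^- (a + b))) => // k.
rewrite norm1_colsum; set cf := track (play s police k).
have cfS : (cf.1 < S)%N := reachable_lt (track_reachable _).
(* The coordinate of the current state has [enc] equal to 1 and alone gives the lower bound on the
   norm. *)
have vc : valid C S (St cf.1) by [].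
have nW : St cf.1 <> W by [].
pose j := Ordinal (index_of_lt vc nW).
rewrite (bigD1 j) //=; have := colsum_police s k j.
rewrite -[X in comp_of _ _ X]/(index_of C S (St cf.1)) index_ofK //.
rewrite [enc _ _ _ _ _]/= eqxx mulr1 => h; rewrite -[leLHS]addr0 lerD //.
apply: sumr_ge0 => i _; apply: le_trans (colsum_police s k i).
by rewrite mulr_ge0 ?enc_ge0 // mulr_ge0 ?invr_ge0 ?exprn_ge0.
Qed.

End EveWins.

(** * Adam stays below 2 if an admissible guess halts *)

Section AdamWins.
Variables (ms : seq move) (rs : nat -> nat).
Hypotheses (run_ms : run P a b ms (start P))
  (final_ms : final ms (start P) = (size P, rs)).

(** The default makes [Halt] the move that follows the legal run. *)
Definition script_move (i : nat) : move := nth (Move (size P) 0 Halt) ms i.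

Definition script_config (i : nat) : config := final (take i ms) (start P).

Lemma script_step i : (i < size ms)%N ->
  [/\ script_move i \in moves P, src (script_move i) = (script_config i).1,
     legal a b (lbl (script_move i)) (script_config i).2 &
     script_config i.+1 = next (script_move i) (script_config i)].
Proof.
rewrite /script_move /script_config; move: run_ms; clear final_ms.
elim: ms i (start P) => // m ms' IHms [|i] cf /= [mP Esrc leg rms] lt_i.
  by rewrite take0.
exact: IHms.
Qed.

Lemma script_move_halt : script_move (size ms) = Move (size P) 0 Halt.
Proof. by rewrite /script_move nth_default. Qed.

Lemma script_config_halt : script_config (size ms) = (size P, rs).
Proof. by rewrite /script_config take_size. Qed.

Lemma script_move_in i : script_move i \in moves P.
Proof.
have [/script_step[]//|le_i] := ltnP i (size ms).
by rewrite /script_move nth_default //; apply: (@guess_moves_in P 4).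
Qed.

(** The position in the script. It returns to 0 after [Halt] even if Eve passes, because the vector
    is then zero. *)
Definition phase (h : history AS ES) : nat :=
  foldl (fun i r => if (val r.2 == restart) || (i == size ms) then 0%N else i.+1)
    (size ms) h.

(* Starting with the halting move projects every row of the product on the
   initial vector. *)
Definition script : adam_strategy AS ES :=
  fun h => adam_play (script_move_in (phase h)).

Lemma phase_le h : (phase h <= size ms)%N.
Proof.
rewrite /phase; elim/last_ind: h => //= h r IHh.
rewrite foldl_rcons; case: ifP => // /negbT; rewrite negb_or => /andP[_ ne].
by rewrite ltn_neqAle ne.
Qed.

Variables (t : eve_strategy AS ES) (l : R).
Hypotheses (l_ge1 : 1 <= l)
  (slow : forall i, (i <= size ms)%N -> 2 ^+ i <= l ^+ i.+1).

Let w0 : R := ((const_mx 1 : 'rV[R]_D) *m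
  adam_R R C S (script_move (size ms))) 0 ord_max.

(** [Halt] moves all surviving mass to [W], so Eve must restart or lose everything. *)
Lemma halt_zero (y : 'rV[R]_D) (j : 'I_D.+1) : j != ord_max ->
  (y *m adam_R R C S (script_move (size ms))) 0 j = 0.
Proof.
move=> ne; rewrite script_move_halt mxE big1 // => i _; rewrite !mxE.
have : comp_of C S j <> W.
  apply: comp_of_neqW; rewrite ltn_neqAle -ltnS ltn_ord andbT.
  exact: ne.
by case: (comp_of C S i) (comp_of C S j) => [?|?|?|||] [?|?|?|||] //= _;
  rewrite ?muln0 ?mulr0.
Qed.

Lemma colsum_scriptS k : colsum script t k.+1 =
  colsum script t k *m adam_R R C S (script_move (phase (play script t k))) *m
    val (t (play script t k) (script (play script t k))).
Proof. exact: colsumS. Qed.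

(** The scale [B] may exceed [w0 * l ^+ k.+1] by the factor [(2 / l)] to the power of the phase;
    this debt is repaid at the next restart. *)
Lemma colsum_script k : exists B,
  [/\ 0 <= B,
     B * l ^+ phase (play script t k.+1) <=
       w0 * l ^+ k.+1 * 2 ^+ phase (play script t k.+1) &
     forall j : 'I_D, colsum script t k.+1 0 j <=
       B * enc R a b (script_config (phase (play script t k.+1))) (comp_of C S j)].
Proof.
have l0 : 0 < l by apply: lt_le_trans l_ge1.
have w0_ge0 : 0 <= w0.
  rewrite /w0 mxE sumr_ge0 // => i _; rewrite mulr_ge0 // !mxE //.
have bound0 n : 0 * l ^+ 0 <= w0 * l ^+ n * 2 ^+ 0.
  by rewrite mul0r mulr_ge0 ?mulr_ge0 ?exprn_ge0 // ltW.
have config0 : script_config 0 = start P by rewrite /script_config take0.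
elim: k => [|k [B [B0 leB hy]]].
  have -> : phase (play script t 1) = 0%N by rewrite /phase /= eqxx orbT.
  rewrite colsum_scriptS config0 /=.
  have -> : colsum script t 0 = const_mx 1.
    by apply/rowP => j; rewrite colsum0 mxE.
  case: (eve_moveP (t [::] (script [::]))) => ->.
    exists 0; split=> // j.
    rewrite pass_R_E halt_zero ?mul0r //.
    by rewrite -val_eqE /= neq_ltn ltn_ord.
  exists w0; split=> //; first by rewrite !expr0 !mulr1 expr1 ler_peMr.
  by move=> j; rewrite restart_R_E start_weightE.
have ac (x y z : R) : x * (l * y) * z = x * y * (l * z) by ring.
have ac2 (x z : R) : x * (l * (2 * z)) = 2 * l * (x * z) by ring.
set h := play script t k.+1 in leB hy *.
have -> : play script t k.+2 = rcons h (script h, t h (script h)) by [].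
rewrite colsum_scriptS -/h; set y := colsum script t k.+1 in hy *.
rewrite /phase foldl_rcons -/(phase h) /=.
have le_ph := phase_le h.
have Esrc : src (script_move (phase h)) = (script_config (phase h)).1.
  move: le_ph; rewrite leq_eqVlt => /orP[/eqP ->|/script_step[]//].
  by rewrite script_move_halt script_config_halt.
have leg : legal a b (lbl (script_move (phase h))) (script_config (phase h)).2
    \/ lbl (script_move (phase h)) = Halt.
  move: le_ph; rewrite leq_eqVlt => /orP[/eqP ->|/script_step[]]; last by left.
  by rewrite script_move_halt; right.
have leW : (y *m adam_R R C S (script_move (phase h))) 0 ord_max <= B.
  have [c0 [z0 le1]] := weight_W_le1 R Esrc leg.
  have := @adam_le R C S a b y B (script_config (phase h))
    (script_move (phase h)) c0 ord_max B0.
  rewrite /= comp_of_dim => /(_ z0 hy) /le_trans; apply.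
  by rewrite ler_piMr.
(* A restart is a round in which [B] does not grow; by [slow] the extra factor [l] covers the
   doublings since the last one. *)
have leB' : B * l ^+ 0 <= w0 * l ^+ k.+2 * 2 ^+ 0.
  rewrite !expr0 !mulr1 -(@ler_pM2r _ (l ^+ phase h)) ?exprn_gt0 //.
  apply: le_trans leB _.
  have lk : 0 <= w0 * l ^+ k.+1 by rewrite mulr_ge0 ?exprn_ge0 // ltW.
  rewrite (exprS l k.+1) ac -(exprS l (phase h)).
  by apply: ler_wpM2l => //; apply: slow.
case: (eve_moveP (t h (script h))) => ->; last first.
  rewrite eqxx /= config0; exists B; split=> // j.
  by rewrite restart_R_E start_weightE ler_wpM2r ?enc_ge0.
case: ifP => [/orP[/eqP E|/eqP E]|nE].
(* Restarts are recognised by comparing matrices, so a passing matrix equal to the restarting one is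
   treated as a restart. *)
- rewrite config0; exists B; split=> // j.
  by rewrite E restart_R_E start_weightE ler_wpM2r ?enc_ge0.
- exists 0; split=> // j; rewrite pass_R_E E halt_zero ?mul0r //.
  by rewrite -val_eqE /= neq_ltn ltn_ord.
have lt_ph : (phase h < size ms)%N.
  by move/negbT: nE; rewrite negb_or ltn_neqAle le_ph => /andP[_ ->].
have [mP _ legal_h ->] := script_step lt_ph.
exists (2 * B); split; first by rewrite mulr_ge0.
  rewrite (exprS l k.+1) ac (exprS l (phase h)) (exprS 2 (phase h)).
  rewrite mulrACA ac2; apply: ler_wpM2l => //.
  by rewrite mulr_ge0 // ltW.
move=> j; rewrite pass_R_E.
have /and3P[srcS _ _] := allP (moves_ok C_gt1 regs_lt) _ mP.
have [c0 [vc0 _ z0 E]] := weight_next R srcS (comp_of_valid C S j)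
  (comp_of_neqW (ltn_ord j)) Esrc legal_h.
rewrite [2 * B]mulrC -mulrA -E.
apply: (@adam_le R C S a b y B (script_config (phase h))
    (script_move (phase h)) c0 (widen_ord (leqnSn D) j) B0) => //= c ne.
by rewrite z0 // mulr0.
Qed.

Lemma payoff_script_le (m : R) : l < m -> (payoff script t <= m%:E)%E.
Proof.
move=> lt_lm; have l0 : 0 < l by apply: lt_le_trans l_ge1.
(* The script has finitely many configurations, so one constant bounds all their encodings. *)
pose K := \sum_(i < (size ms).+1) \sum_(j < D)
  enc R a b (script_config i) (comp_of C S j).
have sum_ge0 i : 0 <= \sum_(j < D) enc R a b (script_config i) (comp_of C S j).
  by apply: sumr_ge0 => j _; apply: enc_ge0.
rewrite payoffE; apply: (@growth_le _ _ (w0 * 2 ^+ size ms * K) l) => // k.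
rewrite sumr_ge0 => [|i _]; last by apply: sumr_ge0 => j _; apply: normr_ge0.
rewrite norm1_colsum /=; have [B [B0 leB hy]] := colsum_script k.
set i := phase _ in leB hy.
apply: (@le_trans _ _ (B * \sum_(j < D) enc R a b (script_config i) (comp_of C S j))).
  by rewrite mulr_sumr; apply: ler_sum => j _; apply: hy.
have leK : \sum_(j < D) enc R a b (script_config i) (comp_of C S j) <= K.
  have lt_i : (i < (size ms).+1)%N by rewrite ltnS phase_le.
  rewrite /K (bigD1 (Ordinal lt_i)) //= lerDl.
  by apply: sumr_ge0 => ? _; apply: sum_ge0.
have leBw : B <= w0 * 2 ^+ size ms * l ^+ k.+1.
  apply: (@le_trans _ _ (B * l ^+ i)).
    by rewrite ler_peMr // exprn_ege1.
  apply: le_trans leB _; rewrite mulrAC ler_wpM2r ?exprn_ge0 ?(ltW l0) //.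
  apply: ler_wpM2l; last by rewrite ler_weXn2l ?ler1n // phase_le.
  by rewrite /w0 mxE sumr_ge0 // => n _; rewrite mulr_ge0 // !mxE.
by rewrite mulrAC; apply: ler_pM.
Qed.

End AdamWins.

Theorem game_value_lt2 : (nat_mmg_value R (game P C a b) < 2%:E)%E <->
  exists x y, [/\ (a <= x)%N, (b <= y)%N & halts P (0%N, regs [:: x; y])].
Proof.
split=> [lt2|[x [y [le_ax le_by halts_xy]]]].
  have [//|never] := pselect (exists x y,
    [/\ (a <= x)%N, (b <= y)%N & halts P (0%N, regs [:: x; y])]).
  by have := eve_value_ge2 never; rewrite leNgt lt2.
have [rs [ms run_ms final_ms]] := can_reach_halting le_ax le_by halts_xy.
have [l [l1 l2 slow]] := slow_rate R (size ms).
(* A bound strictly between [l] and 2 that is the same for all strategies of Eve keeps the supremum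
   below 2. *)
have lt_lm : l < (l + 2) / 2 by lra.
apply: (@le_lt_trans _ _ ((l + 2) / 2)%:E); last by rewrite lte_fin; lra.
apply: ge_ereal_sup => _ [t _ <-].
apply: le_trans (payoff_script_le run_ms final_ms t l1 slow lt_lm).
by apply: ereal_inf_lbound; exists (script run_ms).
Qed.

End Value.

(** * The code of the game *)

Definition apply_ops (w : seq nat) (z : nat) : nat :=
  foldl (fun z d => digit_op d z) z w.

(** The head of the list is the lowest digit, the one that [op_step] executes first. *)
Definition ops_num (w : seq nat) : nat := foldr (fun d t => d + 4 * t) 0 w.

Definition digits_ok (w : seq nat) : bool := all (fun d => 0 < d < 4) w.

Lemma ops_num_lt w : digits_ok w -> ops_num w < 4 ^ size w.
Proof.
elim: w => //= d w IHw /andP[/andP[_ d4] /IHw lt_w].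
by rewrite expnS; lia.
Qed.

(** Nonzero digits make the number at least as large as its length, so [run_ops] iterates often
    enough. *)
Lemma size_ops_num w : digits_ok w -> size w <= ops_num w.
Proof. by elim: w => //= d w IHw /andP[/andP[d0 _] /IHw]; lia. Qed.

Lemma iter_op_step n w z : digits_ok w -> size w <= n ->
  iter n op_step (ops_num w, z) = (0, apply_ops w z).
Proof.
elim: n w z => [|n IHn] [|d w] z //.
  by move=> _ _; rewrite iterSr; apply: (IHn [::]).
move=> /andP[/andP[_ d4] ok] le_w; rewrite iterSr /op_step /=.
by rewrite addnC mulnC divnMDl // divn_small // addn0 modnMDl modn_small // IHn.
Qed.

Lemma run_ops_num w z : digits_ok w -> run_ops (ops_num w) z = apply_ops w z.
Proof. by move=> ok; rewrite /run_ops iter_op_step // size_ops_num. Qed.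

(** Follows [code (n :: s) = 2 ^ n * (2 * code s + 1)]: one operation 2, then [n] doublings, the
    last element of the list first. *)
Fixpoint prefix_ops (s : seq nat) : seq nat :=
  if s is n :: s' then prefix_ops s' ++ 2 :: nseq n 1 else [::].

Lemma apply_ops_cat w1 w2 z : apply_ops (w1 ++ w2) z = apply_ops w2 (apply_ops w1 z).
Proof. by rewrite /apply_ops foldl_cat. Qed.

Lemma apply_prefix_ops s s' :
  apply_ops (prefix_ops s) (CodeSeq.code s') = CodeSeq.code (s ++ s').
Proof.
elim: s => //= n s IHs; rewrite apply_ops_cat IHs /=.
elim: n (_.*2.+1) => [|n IHn] z; first by rewrite mul1n.
by rewrite /= IHn expnS -mul2n mulnCA mulnA.
Qed.

Lemma digits_ok_prefix s : digits_ok (prefix_ops s).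
Proof.
elim: s => //= n s IHs; rewrite /digits_ok all_cat /= -/(digits_ok _) IHs.
by elim: n.
Qed.

Lemma size_prefix_ops s : size (prefix_ops s) = sumn s + size s.
Proof.
elim: s => //= n s IHs; rewrite size_cat /= size_nseq IHs; lia.
Qed.

Lemma size_prefix_le m s : all (fun n => n <= m) s ->
  size (prefix_ops s) <= m.+1 * size s.
Proof.
by rewrite size_prefix_ops; elim: s => //= n s IHs /andP[h /IHs]; lia.
Qed.

(** Each operation appends one binary digit. *)
Lemma code_lt s : CodeSeq.code s < 2 ^ size (prefix_ops s).
Proof.
elim: s => //= n s IHs; rewrite size_cat /= size_nseq addnC expnD expnS.
set c := CodeSeq.code s in IHs *; set x := 2 ^ size _ in IHs *.
rewrite [2 * _]mulnC -mulnA ltn_pmul2l ?expn_gt0 //; lia.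
Qed.

(** Bounds the code of a list of at most [m] numbers, each at most [m]. *)
Definition exp_sq (m : nat) : nat := 2 ^ (m.+1 * m).

Lemma code_le m s : all (fun n => n <= m) s -> size s <= m ->
  CodeSeq.code s <= exp_sq m.
Proof.
move=> h le_s; apply: leq_trans (ltnW (code_lt s)) _.
rewrite leq_exp2l //; apply: leq_trans (size_prefix_le h) _.
by rewrite leq_mul2l le_s orbT.
Qed.

Lemma mx_code_le m n k (X : 'M[nat]_(m, n)) :
  (forall i j, X i j <= k) -> m <= exp_sq k -> n <= k ->
  mx_code X <= exp_sq (exp_sq k).
Proof.
move=> hX le_m le_n; apply: code_le; last by rewrite size_map size_enum_ord.
apply/allP => _ /mapP[i _ ->]; apply: code_le; last first.
  by rewrite size_map size_enum_ord.
by apply/allP => _ /mapP[j _ ->].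
Qed.

Lemma exp_sq_ge m : m <= exp_sq m.
Proof.
by rewrite /exp_sq; apply: leq_trans (ltnW (ltn_expl m (isT : 1 < 2))) _;
  rewrite leq_exp2l // leq_pmull.
Qed.

(** * Operations that produce the code of a game *)

Section GameCode.
Variables (P : program) (C : nat).
Let S := nstates P.
Let D := dim C S.

Lemma weight_le4 m c c' : weight m c c' <= 4.
Proof.
have up4 l j : up l j <= 4 by case: l => //= r; case: eqP.
have down4 l j : down l j <= 4 by case: l => //= r; case: eqP.
case: c c' => [j|j|q||| ] [k|k|q'||| ] //=.
- by case: eqP; rewrite ?mul1n.
- by case: (lbl m) => // r; case: eqP.
- by case: eqP; rewrite ?mul1n.
- by case: (lbl m) => // r; case: eqP.
- by case: (lbl m) => // *; do 2 case: eqP.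
- by case: eqP => // _; case: (lbl m).
- by case: (lbl m).
- by case: (lbl m).
Qed.

(** The part of the start vector without [Al] and [Be]; it is the same for all thresholds, and the
    zeros are placeholders. *)
Definition row_head : seq nat :=
  [seq start_weight P 0 0 (comp_of C S i) | i <- iota 0 (C + C + S)].

Definition zero_rows : seq nat := nseq D (CodeSeq.code (nseq D 0)).

(** Works from the inside out: the seed is the end of the last row of the last matrix of Eve, whose
    list comes last in the code. Operation 3 maps [n] to [2 ^ n], the code of [[:: n]], and so
    closes a level of nesting. *)
Definition game_ops : seq nat :=
  prefix_ops row_head ++ 3 :: prefix_ops zero_rows ++ 3 ::
  prefix_ops [:: mx_code (pass_mx C S)] ++ 3 ::
  prefix_ops [:: D; D.+1; CodeSeq.code [seq mx_code (adam_mx C S m) | m <- moves P]].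

Lemma restart_row a b :
  [seq start_weight P a b (comp_of C S i) | i : 'I_D <- enum 'I_D] =
  row_head ++ [:: 2 ^ a; 2 ^ b].
Proof.
rewrite [LHS](map_comp (fun i => start_weight P a b (comp_of C S i)) val).
rewrite val_enum_ord /D /dim -addn2 iotaD map_cat add0n; congr (_ ++ _).
  apply/eq_in_map => i; rewrite mem_iota /= add0n => lt_i.
  rewrite /comp_of; case: ifP => // _; case: ifP => // _.
  by rewrite lt_i.
have /= -> := @index_ofK C S Al isT.
by have /= -> := @index_ofK C S Be isT.
Qed.

Lemma nseq_ord n (x : nat) : nseq n x = [seq x | _ <- enum 'I_n].
Proof. by rewrite -[in LHS](size_enum_ord n); elim: (enum _) => //= _ s ->. Qed.

Lemma mx_code_restart a b : mx_code (restart_mx C S (start_weight P a b)) =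
  CodeSeq.code (zero_rows ++ [:: CodeSeq.code (row_head ++ [:: 2 ^ a; 2 ^ b])]).
Proof.
rewrite /mx_code enum_ordSr map_rcons -cats1.
congr (CodeSeq.code (_ ++ [:: CodeSeq.code _])); last first.
  by rewrite -restart_row; apply: eq_map => j; rewrite mxE /= eqxx.
rewrite -map_comp /zero_rows.
have -> : nseq D (CodeSeq.code (nseq D 0)) =
    [seq CodeSeq.code (nseq D 0) | _ <- enum 'I_D].
  exact: nseq_ord.
apply: eq_map => i; apply: (congr1 CodeSeq.code).
have -> : nseq D 0 = [seq 0 | _ <- enum 'I_D].
  exact: nseq_ord.
by apply: eq_map => j; rewrite mxE /= ltn_eqF.
Qed.

Lemma game_codeE a b :
  nat_mmg_code (game P C a b) = apply_ops game_ops (seed a b).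
Proof.
transitivity (CodeSeq.code [:: D; D.+1;
  CodeSeq.code [seq mx_code X | X <- [seq adam_mx C S m | m <- moves P]];
  CodeSeq.code [:: mx_code (pass_mx C S);
                   mx_code (restart_mx C S (start_weight P a b))]]); first by [].
rewrite -map_comp mx_code_restart /game_ops.
have -> : seed a b = CodeSeq.code [:: 2 ^ a; 2 ^ b] by rewrite /= muln1.
have single w n : apply_ops (3 :: w) n = apply_ops w (CodeSeq.code [:: n]).
  by rewrite /= muln1.
rewrite apply_ops_cat apply_prefix_ops single.
rewrite apply_ops_cat apply_prefix_ops single.
by rewrite apply_ops_cat apply_prefix_ops single apply_prefix_ops.
Qed.

Lemma digits_ok_game_ops : digits_ok game_ops.
Proof.
have ok_cat w1 w2 : digits_ok (w1 ++ 3 :: w2) = digits_ok w1 && digits_ok w2.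
  by rewrite /digits_ok all_cat.
by rewrite /game_ops !ok_cat !digits_ok_prefix.
Qed.

(** Exceeds the dimensions, the number of moves and the entries of the fixed matrices. *)
Definition size_bound : nat := 2 * C + 2 * size P + 10.

Lemma size_moves : size (moves P) <= 5 + 2 * size P.
Proof.
rewrite size_cat leq_add2l size_flatten /shape -map_comp.
have h i : size (instr_moves P i) <= 2.
  by rewrite /instr_moves; case: (nth _ P i).
suff : forall s, sumn [seq (size \o instr_moves P) i | i <- s] <= 2 * size s.
  by move/(_ (iota 0 (size P))); rewrite size_iota.
by elim=> //= i s IHs; have := h i; lia.
Qed.

(** Rows, matrices and lists of matrices are three nested codes, one [exp_sq] each; [prefix_ops] is
    unary, hence linear in these codes. *)
Lemma size_game_ops : size game_ops <= 11 * exp_sq (exp_sq (exp_sq size_bound)).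
Proof.
set X := size_bound; set X1 := exp_sq X; set X2 := exp_sq X1; set X3 := exp_sq X2.
have DX : D < X by rewrite /D /dim /S /nstates /X /size_bound; lia.
have X_ge : 10 <= X by rewrite /X /size_bound; lia.
have le01 : X <= X1 := exp_sq_ge X.
have le12 : X1 <= X2 := exp_sq_ge X1.
have le23 : X2 <= X3 := exp_sq_ge X2.
have sq_le m : m.+1 * m <= exp_sq m by rewrite ltnW // ltn_expl.
have s1 : size (prefix_ops row_head) <= X3.
  apply: leq_trans (_ : X.+1 * X <= X3); last first.
    by apply: leq_trans (sq_le X) _; lia.
  apply: leq_trans (size_prefix_le (m := X) _) _.
    apply/allP => _ /mapP[i _ ->]; apply: (@leq_trans 1); last lia.
    by case: (comp_of C S i) => //= q; apply: leq_b1.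
  by rewrite leq_mul2l size_map size_iota; move: DX; rewrite /D /dim; lia.
have s2 : size (prefix_ops zero_rows) <= X3.
  apply: leq_trans (_ : X1.+1 * X1 <= X3); last first.
    by apply: leq_trans (sq_le X1) _; lia.
  apply: leq_trans (size_prefix_le (m := X1) _) _.
    apply/allP => _ /nseqP[-> _]; apply: code_le; last by rewrite size_nseq; lia.
    by apply/allP => _ /nseqP[-> _].
  by rewrite leq_mul2l size_nseq; lia.
have s3 : size (prefix_ops [:: mx_code (pass_mx C S)]) <= X3.+1.
  rewrite size_prefix_ops /= addn0 addn1 ltnS.
  apply: leq_trans le23; apply: mx_code_le.
  - by move=> i j; rewrite mxE; apply: leq_trans (leq_b1 _) _; lia.
  - by apply: leq_trans le01; rewrite -/D; lia.
  - by rewrite -/D; lia.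
have s4 : CodeSeq.code [seq mx_code (adam_mx C S m) | m <- moves P] <= X3.
  apply: code_le; last first.
    rewrite size_map; apply: leq_trans size_moves _.
    by apply: leq_trans le12; apply: leq_trans le01; rewrite /X /size_bound; lia.
  apply/allP => _ /mapP[m _ ->]; apply: mx_code_le.
  - move=> i j; rewrite mxE; apply: leq_trans (weight_le4 _ _ _) _; lia.
  - by apply: leq_trans le01; rewrite -/D; lia.
  - by rewrite -/D; lia.
have size_cat3 w1 w2 : size (w1 ++ 3 :: w2) = size w1 + (size w2).+1.
  by rewrite size_cat.
rewrite /game_ops !size_cat3 (size_prefix_ops [:: D; _; _]).
move: s1 s2 s3 s4; set c := CodeSeq.code _; set c1 := size _; set c2 := size _.
set c3 := size _; rewrite [sumn _]/= [size _]/=; lia.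
Qed.

(** Each of the three [exp_sq] costs three exponentials, and two more cover [4 ^ (11 * V)]. *)
Lemma ops_num_game_ops :
  ops_num game_ops <= iter 11 (expn 2) size_bound.
Proof.
have exp_sq_le m : exp_sq m <= iter 3 (expn 2) m.
  rewrite /= leq_exp2l //.
  have le2m k : 2 * k <= 2 ^ k.
    by elim: k => // k IHk; rewrite expnS mulnS; have := expn_gt0 2 k; lia.
  apply: (@leq_trans (2 ^ (2 * m))); last by rewrite leq_exp2l.
  rewrite mul2n -addnn expnD.
  by apply: leq_mul; [exact: ltn_expl | apply: ltnW; exact: ltn_expl].
have mono k m n : m <= n -> iter k (expn 2) m <= iter k (expn 2) n.
  by move=> h; elim: k => //= k IHk; rewrite leq_exp2l.
set X := size_bound; set V := exp_sq (exp_sq (exp_sq X)).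
have leV : V <= iter 9 (expn 2) X.
  apply: leq_trans (exp_sq_le _) _; rewrite [iter 9 _ _](iterD 3 6); apply: (mono 3).
  apply: leq_trans (exp_sq_le _) _; rewrite [iter 6 _ _](iterD 3 3); apply: (mono 3).
  exact: exp_sq_le.
apply: leq_trans (mono 2 _ _ leV).
apply: leq_trans (ltnW (ops_num_lt digits_ok_game_ops)) _ => /=.
rewrite -[4]/(2 ^ 2) -expnM leq_exp2l //.
apply: (@leq_trans (22 * V)); first by have := size_game_ops; rewrite -/X -/V; lia.
have V_ge : 10 <= V.
  apply: leq_trans (exp_sq_ge _); apply: leq_trans (exp_sq_ge _).
  by apply: leq_trans (exp_sq_ge _); rewrite /X /size_bound; lia.
rewrite -(subnK V_ge); elim: (V - 10) => // n IHn.
by rewrite addSn expnS mulnS; lia.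
Qed.

End GameCode.

Lemma tower_ge n : n <= tower n.
Proof. by elim: n => //= n IHn; apply: leq_ltn_trans IHn (ltn_expl _ _). Qed.

Lemma tower_beats k : exists e, iter 11 (expn 2) (2 * e + k) <= tower e.
Proof.
have le_exp n : n + (n + 6) + 13 <= 2 ^ (n + 6).
  by elim: n => // n IHn; rewrite !addSn expnS; lia.
pose f := k + 6.
(* Eleven levels cancel the iterate; the other [f.+2] give at least [2 ^ (2 ^ f)], which exceeds the
   linear argument. *)
exists (11 + f.+2); rewrite /tower iterD.
have mono j m n : m <= n -> iter j (expn 2) m <= iter j (expn 2) n.
  by move=> h; elim: j => //= j IHj; rewrite leq_exp2l.
apply: mono; apply: (@leq_trans (2 ^ (2 ^ f))); last first.
  by rewrite /= !leq_exp2l //; apply: tower_ge.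
apply: (@leq_trans (2 ^ f.+1)); last by rewrite leq_exp2l // ltn_expl.
by rewrite expnS; have := le_exp k; rewrite -/f; lia.
Qed.

(** * Undecidability *)

Definition max_reg (p : program) : nat := \max_(i <- p) reg_of i.

Lemma all_reg_compile z o c k : z < k -> all (fun r => r < k) (writes c) ->
  all (fun i => reg_of i < k) (compile z o c).
Proof.
move=> ltz; elim: c o => //= [c1 IH1 c2 IH2|r c IH] o.
  by rewrite !all_cat => /andP[/IH1 -> /IH2 ->].
by case/andP=> -> /IH h; rewrite all_rcons /= ltz h.
Qed.

Lemma all_max_reg p : all (fun i => reg_of i <= max_reg p) p.
Proof.
rewrite /max_reg; elim: p => //= i p IHp; rewrite big_cons leq_maxl /=.
by apply: sub_all IHp => j /= h; rewrite leq_max h orbT.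
Qed.

Lemma regs_diag e p :
  all (fun i => reg_of i < 20 + max_reg p) (diag e p).
Proof.
have sub s : all (fun i => reg_of i < 20) s ->
    all (fun i => reg_of i < 20 + max_reg p) s.
  by apply: sub_all => j /= h; lia.
rewrite all_cat; apply/andP; split.
  apply: sub; apply: all_reg_compile => //.
  by apply: sub_all (writes_start e) => j /= h; lia.
rewrite all_cat; apply/andP; split; first exact: sub.
rewrite all_cat; apply/andP; split; first by apply: sub; apply: all_reg_compile.
rewrite all_cat; apply/andP; split; last exact: sub.
rewrite all_map; apply: sub_all (all_max_reg p) => i /=.
by case: i => [r|r l] /=; lia.
Qed.

(** Linear in [e], so [tower e] eventually exceeds the number of the operations for the program's
    own game. *)
Lemma size_diag_add e p : size (diag e p) = e + size (diag 0 p).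
Proof.
rewrite !size_diag /off_end /off_p /off_load /off_test.
suff -> : csize (cmd_start e) = e + csize (cmd_start 0) by lia.
by rewrite /cmd_start; elim: e => //= e ->.
Qed.

Local Open Scope ring_scope.
Local Open Scope ereal_scope.

Theorem theorem6 (R : realType) :
  undecidable nat_mmg_code (fun G : nat_mmg => nat_mmg_value R G < 2%:E).
Proof.
(* This number of counters works for every [e], so it is fixed before [e] is chosen. *)
case=> p dec; pose C := (20 + max_reg p)%N.
have [e le_e] := tower_beats (2 * C + 2 * size (diag 0 p) + 10).
pose P := diag e p; pose t := ops_num (game_ops P C).
have le_t : (t <= tower e)%N.
  apply: leq_trans (ops_num_game_ops P C) _.
  rewrite (_ : size_bound P C = 2 * e + (2 * C + 2 * size (diag 0 p) + 10))%N //.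
  by rewrite /size_bound /P size_diag_add; lia.
(* The thresholds add up to the bound of the program, so [(t, u)] is the only guess that meets all
   three inequalities. *)
pose u := (tower e - t)%N; pose G := game P C t u.
have regs_lt : all (fun i => reg_of i < C)%N P := regs_diag e p.
have value_lt2 : nat_mmg_value R G < 2%:E <-> halts P (0%N, regs [:: t; u]).
  apply: iff_trans (game_value_lt2 R t u _ regs_lt) _; first by rewrite /C; lia.
  split=> [[x [y [le_x le_y h]]]|h]; last by exists t, u.
  have le_xy : (x + y <= tower e)%N.
    by rewrite leqNgt; apply/negP => /(@diag_overflow e p).
  have [-> ->] : t = x /\ u = y by rewrite /u in le_y *; lia.
  exact: h.
(* Self-reference: executing [t] on the seed of [(t, u)] yields the code of the game with these
   thresholds. *)
have codeE : nat_mmg_code G = run_ops t (seed t u).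
  by rewrite game_codeE run_ops_num // digits_ok_game_ops.
have halts_out v : outputs p (nat_mmg_code G) v ->
    halts P (0%N, regs [:: t; u]) <-> v = 0%N.
  by rewrite codeE; apply: diag_halts; rewrite /u; lia.
have [out1 out0] := dec G.
(* If the value were below 2, the answer 1 would prevent halting; hence the answer is 0, the program
   halts and the value is below 2 after all. *)
have not_lt2 : ~ nat_mmg_value R G < 2%:E.
  by move=> lt2; have [h _] := halts_out _ (out1 lt2); have := h (value_lt2.1 lt2).
apply: (not_lt2); apply/value_lt2.
by apply/(halts_out 0%N) => //; apply: out0.
Qed.
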